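(* $\mathsf C_{2^{\mathbb N}}^\infty\equiv_{\mathrm{sW}}\mathsf C_{2^{\mathbb N}}$, $\mathsf C_{\mathbb N^{\mathbb N}}^\infty\equiv_{\mathrm{sW}}\mathsf C_{\mathbb N^{\mathbb N}}$, $\mathsf{UC}_{\mathbb N^{\mathbb N}}^\infty\equiv_{\mathrm{sW}}\mathsf{UC}_{\mathbb N^{\mathbb N}}$ and $\mathsf{WKL}^\infty\equiv_{\mathrm{sW}}\mathsf{WKL}$.
   Context: Problems. A represented space $(X,\delta_X)$ is a set $X$ with a surjective partial map $\delta_X:\subseteq\mathbb N^{\mathbb N}\to X$. A partial function $F:\subseteq\mathbb N^{\mathbb N}\to\mathbb N^{\mathbb N}$ is computable if there is a computable monotone (w.r.t. the prefix order) word function $\varphi:\mathbb N^*\to\mathbb N^*$ with $F(p)=\sup_{w\sqsubseteq p}\varphi(w)$ for all $p\in\mathrm{dom}(F)$. For a partial multivalued function $f:\subseteq X\rightrightarrows Y$ between represented spaces, $F:\subseteq\mathbb N^{\mathbb N}\to\mathbb N^{\mathbb N}$ is a realizer of $f$, written $F\vdash f$, if $\delta_YF(p)\in f\delta_X(p)$ for all $p\in\mathrm{dom}(f\delta_X)$. A problem is a multivalued function with a realizer. Composition: $g\circ f(x)=\{z:(\exists y\in f(x))\,z\in g(y)\}$ with $\mathrm{dom}(g\circ f)=\{x\in\mathrm{dom}(f):f(x)\subseteq\mathrm{dom}(g)\}$. The realizer version of $f$ is $f^{\mathrm r}:=\delta_Y^{-1}\circ f\circ\delta_X:\subseteq\mathbb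 N^{\mathbb N}\rightrightarrows\mathbb N^{\mathbb N}$. Tupling. $\langle q,p\rangle:=q(0)p(0)q(1)p(1)\dots$, and $\langle p_0,p_1,p_2,\dots\rangle$ is the standard countable tupling, e.g. $\langle p_0,p_1,\dots\rangle(\langle i,j\rangle)=p_i(j)$. $\langle\mathrm{id}\times f\rangle$ is the problem $\langle q,p\rangle\mapsto\{\langle q,r\rangle:r\in f(p)\}$. Universal function. $\Phi$ is a fixed standard total representation of a set of continuous partial functions on $\mathbb N^{\mathbb N}$ (with natural domains), where a name $q$ encodes the graph of a monotone word function approximating $\Phi_q$; $\mathsf U_q:=\Phi_q$, and $\mathsf U\langle q,p\rangle:=\mathsf U_q(p)$ is a computable partial function. The smn-theorem holds: for every computable (continuous) $F:\subseteq\mathbb N^{\mathbb N}\to\mathbb N^{\mathbb N}$ there is a total computable (continuous) $S$ with $\mathsf U_{S(q)}(p)=F\langle q,p\rangle$ for all $\langle q,p\rangle\in\mathrm{dom}(F)$. Infinite loop. For a problem $f:\subseteq\mathbb N^{\mathbb N}\rightrightarrows\mathbb N^{\mathbb N}$, $f^\infty(q_0):=\{\langle q_0,q_1,q_2,\dots\rangle:(\forall i)\ q_{i+1}\in\mathsf U\circ\langle\mathrm{id}\times f\rangle(q_i)\}$, with $\mathrm{dom}(f^\infty)$ the set of all $q_0$ such that $A_0:=\{q_0\}\subseteq\mathrm{dom}(\mathsf U\circ\langle\mathrm{id}\times f\rangle)$ and $A_{i+1}:=\mathsf U\circ\langle\mathrm{id}\times f\rangle(A_i)\subseteq\mathrm{dom}(\mathsf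 U\circ\langle\mathrm{id}\times f\rangle)$ for all $i$. For arbitrary $f$, $f^\infty:=(f^{\mathrm r})^\infty$. Strong Weihrauch reducibility. $f\le_{\mathrm{sW}}g$ if there are computable $H,K:\subseteq\mathbb N^{\mathbb N}\to\mathbb N^{\mathbb N}$ with $HGK\vdash f$ whenever $G\vdash g$; $\equiv_{\mathrm{sW}}$ is the induced equivalence. Specific problems. $\mathsf C_X:\subseteq\mathcal A_-(X)\rightrightarrows X$, $B\mapsto B$, with domain the nonempty closed sets, where $\mathcal A_-(X)$ is the space of closed subsets of $X$ represented by negative information (a name of $B$ is an enumeration of cylinder sets whose union is $X\setminus B$, for $X=2^{\mathbb N},\mathbb N^{\mathbb N}$). $\mathsf{UC}_X$ is the restriction of $\mathsf C_X$ to singletons. $\mathsf{WKL}:\subseteq\mathrm{Tr}_2\rightrightarrows2^{\mathbb N}$, $T\mapsto[T]$, maps every infinite binary tree $T$ (given by its characteristic function) to the set $[T]$ of its infinite paths. *)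

(* Defs.v *)
From Stdlib Require Cantor.
From mathcomp Require Import all_boot.
From mathcomp Require Import boolp classical_sets functions cardinality.
From mathcomp Require Import topology.

Set Implicit Arguments.
Unset Strict Implicit.
Unset Printing Implicit Defensive.

Local Open Scope classical_set_scope.

(* The class of (total) recursive functions: the least class that contains the
   initial functions and is closed under composition, primitive recursion and
   minimization of regular functions. *)
Inductive recursive : forall k, (k.-tuple nat -> nat) -> Prop :=
| recursive_zero k : recursive (fun _ : k.-tuple nat => 0)
| recursive_succ : recursive (fun v : 1.-tuple nat => (thead v).+1)
| recursive_proj k (i : 'I_k) : recursive (fun v : k.-tuple nat => tnth v i)
| recursive_comp k m (g : m.-tuple nat -> nat)
    (h : 'I_m -> k.-tuple nat -> nat) :
    recursive g -> (forall i, recursive (h i)) ->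
    recursive (fun v : k.-tuple nat => g [tuple h i v | i < m])
| recursive_prim k (g : k.-tuple nat -> nat) (h : k.+2.-tuple nat -> nat)
    (f : k.+1.-tuple nat -> nat) :
    recursive g -> recursive h ->
    (forall v : k.-tuple nat, f [tuple of 0 :: v] = g v) ->
    (forall n (v : k.-tuple nat), f [tuple of n.+1 :: v] =
                 h [tuple of n :: f [tuple of n :: v] :: v]) ->
    recursive f
| recursive_min k (g : k.+1.-tuple nat -> nat) (f : k.-tuple nat -> nat) :
    recursive g ->
    (forall v : k.-tuple nat, g [tuple of f v :: v] = 0 /\
               forall m, g [tuple of m :: v] = 0 -> f v <= m) ->
    recursive f.

Definition recursive1 (f : nat -> nat) : Prop :=
  recursive (fun v : 1.-tuple nat => f (thead v)).

(* [CodeSeq.code] is a bijection from words over [nat] onto [nat], with inverse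
   [CodeSeq.decode]. *)
Definition computable_word (phi : seq nat -> seq nat) : Prop :=
  recursive1 (CodeSeq.code \o phi \o CodeSeq.decode).

Definition baire : Type := nat -> nat.

Definition monotone_word (phi : seq nat -> seq nat) : Prop :=
  forall v w, prefix v w -> prefix (phi v) (phi w).

(* [r] is the supremum, in the prefix order, of the words [phi w] for all
   finite prefixes [w = mkseq p n] of [p]. *)
Definition is_sup (phi : seq nat -> seq nat) (p r : baire) : Prop :=
  (forall n, phi (mkseq p n) = mkseq r (size (phi (mkseq p n)))) /\
  (forall m, exists n, m <= size (phi (mkseq p n))).

(* A partial multivalued function from [X] to [Y] is a map [f : X -> set Y];
   its domain consists of the points with a nonempty set of values.  It is a
   partial (single-valued) function if [is_fun f]. *)
Definition dom X Y (f : X -> set Y) : set X := [set x | f x !=set0].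

Definition mcomp X Y Z (g : Y -> set Z) (f : X -> set Y) : X -> set Z :=
  fun x => [set z | f x `<=` dom g /\ exists2 y, f x y & g y z].

Lemma dom_mcomp X Y Z (g : Y -> set Z) (f : X -> set Y) :
  dom (mcomp g f) = [set x | dom f x /\ f x `<=` dom g].
Proof.
apply/seteqP; split=> x /=.
  by move=> [z [fg [y fxy _]]]; split=> //; exists y.
by move=> [[y fxy] fg]; have [z gyz] := fg _ fxy; exists z; split=> //; exists y.
Qed.

Definition computable (F : baire -> set baire) : Prop :=
  exists phi, [/\ computable_word phi, monotone_word phi &
    forall p r, F p r -> is_sup phi p r].

(* [name] is the graph of the representation: [name p x] states that [x] is the value of the representation at [p]. *)
Record repspace := RepSpace {
  point : Type;
  name : baire -> set point;
  name_fun : is_fun name;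
  name_surj : forall x, exists p, name p x }.

Definition problem (X Y : repspace) : Type := point X -> set (point Y).

Definition realizes (X Y : repspace) (F : baire -> set baire)
    (f : problem X Y) : Prop :=
  forall p, dom (mcomp f (@name X)) p ->
    exists2 r, F p r & exists2 y, @name Y r y & mcomp f (@name X) p y.

(* A problem is required to have a realizer; by choice this always holds. *)
Lemma problem_realizer (X Y : repspace) (f : problem X Y) :
  exists2 F, is_fun F & realizes F f.
Proof.
pose P p r := exists2 y, @name Y r y & mcomp f (@name X) p y.
have h p : exists r, dom (mcomp f (@name X)) p -> P p r.
  have [[y fy]|nd] := pselect (dom (mcomp f (@name X)) p).
    by have [r ry] := name_surj y; exists r => _; exists y.
  by exists id.
have [F FP] := choice h.
exists (fun p => [set F p]); first by move=> p q r /= -> ->.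
by move=> p dp; exists (F p) => //; apply: FP.
Qed.

Definition baire_rep : repspace.
refine (@RepSpace baire (fun p => [set p]) _ _).
- by move=> p x y /= -> ->.
- by move=> x; exists x.
Defined.

Definition realizer_version (X Y : repspace) (f : problem X Y) :
    problem baire_rep baire_rep :=
  mcomp (fun y : point Y => [set r | @name Y r y]) (mcomp f (@name X)).

Definition sW_le (X Y Z W : repspace) (f : problem X Y) (g : problem Z W) :
    Prop :=
  exists H K : baire -> set baire,
    [/\ is_fun H /\ computable H, is_fun K /\ computable K &
      forall G : baire -> set baire, is_fun G -> realizes G g ->
        realizes (mcomp H (mcomp G K)) f].

Definition sW_equiv (X Y Z W : repspace) (f : problem X Y)
    (g : problem Z W) : Prop :=
  sW_le f g /\ sW_le g f.

Definition pair_baire (q p : baire) : baire :=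
  fun n => if odd n then p n./2 else q n./2.

Definition tuple_baire (s : nat -> baire) : baire :=
  fun n => s (Cantor.of_nat n).1 (Cantor.of_nat n).2.

Definition word_fun (q : baire) (w : seq nat) : seq nat :=
  CodeSeq.decode (q (CodeSeq.code w)).

(* Every [q] is read as the graph of a word function [word_fun q], and the
   domain of [Phi q] is the natural one: it consists of all [p] for which the
   supremum of the words [word_fun q w], for [w] a prefix of [p], exists and is
   infinite.  Every monotone word function is some [word_fun q]. *)
Definition Phi (q : baire) : baire -> set baire :=
  fun p => [set r | is_sup (word_fun q) p r].

Lemma Phi_fun q : is_fun (Phi q).
Proof.
move=> p r s [hr ur] [hs _]; apply/funext => i.
have [n hn] := ur i.+1.
have /(congr1 (fun w => nth 0 w i)) := etrans (esym (hr n)) (hs n).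
by rewrite !nth_mkseq.
Qed.

Definition univ : baire -> set baire :=
  fun s => [set r | exists q p, s = pair_baire q p /\ Phi q p r].

Definition id_times (f : baire -> set baire) : baire -> set baire :=
  fun s => [set t | exists q p r,
    [/\ s = pair_baire q p, t = pair_baire q r & f p r]].

Definition loop_body (f : baire -> set baire) : baire -> set baire :=
  mcomp univ (id_times f).

Fixpoint loop_stage (f : baire -> set baire) (q0 : baire) (i : nat) :
    set baire :=
  if i is j.+1 then \bigcup_(q in loop_stage f q0 j) loop_body f q
  else [set q0].

Definition loop_dom (f : baire -> set baire) : set baire :=
  [set q0 | forall i, loop_stage f q0 i `<=` dom (loop_body f)].

Definition loop_baire (f : baire -> set baire) : baire -> set baire :=
  fun q0 => [set t | loop_dom f q0 /\
    exists s : nat -> baire, [/\ s 0 = q0,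
      forall i, loop_body f (s i) (s i.+1) & t = tuple_baire s]].

Lemma dom_loop_baire f : dom (loop_baire f) = loop_dom f.
Proof.
apply/seteqP; split=> [q0 [t []] //|q0 d0].
have h q : exists r, dom (loop_body f) q -> loop_body f q r.
  have [[r hr]|nd] := pselect (dom (loop_body f) q); first by exists r.
  by exists id.
have [F FP] := choice h.
pose s i := iter i F q0.
have st i : loop_stage f q0 i (s i).
  elim: i => [|i IH] //=; exists (s i) => //; apply: FP; exact: d0 IH.
exists (tuple_baire s); split=> //; exists s; split=> // i.
by apply: FP; apply: d0 (st i).
Qed.

Definition infloop (X Y : repspace) (f : problem X Y) :
    problem baire_rep baire_rep :=
  loop_baire (realizer_version f).

Section SequenceSpace.
(* The sequences over a discrete alphabet [A] whose letters are coded by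
   natural numbers: [A = nat] gives Baire space, [A = bool] Cantor space. *)
Variables (A : discreteTopologicalType) (c : A -> nat).
Hypothesis c_inj : injective c.

Definition seq_rep : repspace.
refine (@RepSpace {ptws nat -> A} (fun p => [set x | p = c \o x]) _ _).
- move=> p x y /= -> cxy; apply/funext => n; apply: c_inj.
  exact: (congr1 (fun s => s n) cxy).
- by move=> x; exists (c \o x).
Defined.

(* If [A = bool], then a word with a letter above 1 has the empty cylinder. *)
Definition cylinder (w : seq nat) : set {ptws nat -> A} :=
  [set x | mkseq (c \o x) (size w) = w].

(* [0] enumerates nothing, so that the whole space has a name, too. *)
Definition enum_cylinder (n : nat) : set {ptws nat -> A} :=
  if n is m.+1 then cylinder (CodeSeq.decode m) else set0.

Definition closed_set : Type := {B : set {ptws nat -> A} | closed B}.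

Definition neg_name (p : baire) : set closed_set :=
  [set B | ~` sval B = \bigcup_i enum_cylinder (p i)].

Lemma open_cylinder (U : set {ptws nat -> A}) x : open U -> U x ->
  exists n, cylinder (mkseq (c \o x) n) `<=` U.
Proof.
move=> oU Ux.
pose F : set_system {ptws nat -> A} :=
  filter_from setT (fun n => cylinder (mkseq (c \o x) n)).
have cylP n y : cylinder (mkseq (c \o x) n) y <->
    forall i, i < n -> y i = x i.
  rewrite /cylinder /= size_mkseq; split=> [e i lin|e].
    have := congr1 (fun w => nth 0 w i) e; rewrite !nth_mkseq //.
    exact: c_inj.
  by apply/eq_in_map => i; rewrite mem_iota /= => lin; rewrite /= e.
have FF : Filter F.
  apply: filter_from_filter; first by exists 0.
  move=> m n _ _; exists (maxn m n) => // y /cylP yx.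
  by split; apply/cylP => i lti; apply: yx; rewrite leq_max lti ?orbT.
have : F --> (x : {ptws nat -> A}).
  apply/cvg_sup => i; apply/cvg_image.
    by apply/seteqP; split=> // a _; exists (fun=> a).
  move=> V /= /nbhs_singleton Vx.
  exists ((fun f : nat -> A => f i) @^-1` V).
    by exists i.+1 => // y /cylP yx /=; rewrite yx.
  apply/seteqP; split=> [_ [y ? <-] //|a Va]; by exists (fun=> a).
by move=> /(_ _ (open_nbhs_nbhs (conj oU Ux))) [n _ nU]; exists n.
Qed.

Lemma neg_name_fun : is_fun neg_name.
Proof.
move=> p [B cB] [C cC]; rewrite /neg_name /= => <- /(congr1 setC).
by rewrite !setCK => CB; apply: eq_exist.
Qed.

Lemma neg_name_surj (B : closed_set) : exists p, neg_name p B.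
Proof.
case: B => B cB.
pose inside n := enum_cylinder n `<=` ~` B.
exists (fun n => if asbool (inside n) then n else 0).
rewrite /neg_name /=; apply/seteqP; split=> x.
  move=> nBx; have [n hn] := open_cylinder (closed_openC cB) nBx.
  exists (CodeSeq.code (mkseq (c \o x) n)).+1 => //.
  rewrite asboolT /inside /= CodeSeq.codeK //.
  by rewrite /cylinder /= size_mkseq.
by move=> [n _]; case: asboolP => // /[apply].
Qed.

Definition closed_rep : repspace := RepSpace neg_name_fun neg_name_surj.

Definition closed_choice : problem closed_rep seq_rep := fun B => sval B.

Definition unique_choice : problem closed_rep seq_rep :=
  fun B => [set x | (exists y, sval B = [set y]) /\ closed_choice B x].

End SequenceSpace.

Arguments closed_choice {A c} c_inj B.
Arguments unique_choice {A c} c_inj B.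

Lemma nat_of_bool_inj : injective nat_of_bool.
Proof. by case; case. Qed.

Definition cantor_rep : repspace := seq_rep nat_of_bool_inj.

Definition C_cantor := closed_choice nat_of_bool_inj.
Definition C_baire := closed_choice (@inj_id nat).
Definition UC_baire := unique_choice (@inj_id nat).

(* Words over {0, 1} are words over [nat] with letters below 2. *)
Definition is_binary_tree (T : pred (seq nat)) : Prop :=
  (forall w, T w -> all (fun a => a < 2) w) /\
  (forall v w, prefix v w -> T w -> T v).

Definition binary_tree : Type := {T : pred (seq nat) | is_binary_tree T}.

Definition tree_name (p : baire) : set binary_tree :=
  [set T | forall w, p (CodeSeq.code w) = nat_of_bool (sval T w)].

Definition tree_rep : repspace.
refine (@RepSpace binary_tree tree_name _ _).
- move=> p [S hS] [T hT]; rewrite /tree_name /= => pS pT; apply: eq_exist.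
  by apply/funext => w; apply: nat_of_bool_inj; rewrite -pS -pT.
- move=> [T hT]; exists (fun n => nat_of_bool (T (CodeSeq.decode n))) => w /=.
  by rewrite CodeSeq.codeK.
Defined.

Definition WKL : problem tree_rep cantor_rep :=
  fun T => [set x | infinite_set [set w | sval T w] /\
    forall n, sval T (mkseq (nat_of_bool \o x) n)].

(* Main.v *)
Require Import Defs.
From Stdlib Require Cantor.
From mathcomp Require Import all_boot.
From mathcomp Require Import boolp classical_sets functions cardinality.
From mathcomp Require Import topology.

(* [f] reduces to [f^oo]: the input [p] becomes the loop input [<e, p>], where
   [e] sends an answer [r] of [f] on [p] to [<q_r, p0>].  Here [p0] is a
   computable name on which the only answer is the zero sequence, and [q_r] is a
   quine which sends that answer back to [<q_r, p0>] and in which [r] is hidden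
   among unused letters.  Hence the loop runs on forever, and its second entry
   determines [r].

   [f^oo] reduces to [f]: the sequences [<graph of q0, r_0, r_1, ...>], in which
   every [r_i] is a correct answer in the [i]-th stage of a run on [q0], form a
   set whose complement is enumerable from [q0]: the stages are computed from
   [q0] and the [r_i], and a wrong [r_i] is refuted by finite information.  The
   convergence of the stages need not be checked, because it is guaranteed by
   [q0] being in the domain of [f^oo].  Such a sequence contains all that is
   needed to compute the run, and it is unique if every [r_i] is. *)

Set Implicit Arguments.
Unset Strict Implicit.
Unset Printing Implicit Defensive.

Local Open Scope classical_set_scope.

(** * Recursive functions *)

(** The four problems share one feature: on their domain, wrong answers are refutable from finite
    prefixes. The predicates [letter] and [reject] isolate this feature. It is asked on the domain
    only, so that promises such as being a singleton or an infinite tree are never tested. Whether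
    r_i is rejected depends on stage i, which is meaningful only if the earlier answers are right;
    for a wrong candidate, the stages may not exist as sequences at all. Therefore stages are
    computed as finite words by total functions. That these words approximate the true stages is
    proved together with the correctness of the answers, by one induction on i. The reductions are
    strong: the postprocessing sees nothing but the sequence of answers, so the input has to be
    contained in it. In the other direction, the domain of the loop demands that a program converges
    on every possible answer. This is why the question that is repeated has a single answer: the
    quine is then controlled on one sequence only, and its letters can be written down by recursion
    on the position. *)

Lemma recursive_nth k i : i < k ->
  recursive (fun v : k.-tuple nat => nth 0 v i).
Proof.
move=> ik; have -> : (fun v : k.-tuple nat => nth 0 v i) =
    (fun v => tnth v (Ordinal ik)).
  by apply/funext => v; rewrite (tnth_nth 0).
exact: recursive_proj.
Qed.

Definition recursive2 (g : nat -> nat -> nat) : Prop :=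
  recursive (fun v : 2.-tuple nat => g (nth 0 v 0) (nth 0 v 1)).

Definition recursive3 (g : nat -> nat -> nat -> nat) : Prop :=
  recursive (fun v : 3.-tuple nat => g (nth 0 v 0) (nth 0 v 1) (nth 0 v 2)).

Lemma recursive1E g :
  recursive1 g = recursive (fun v : 1.-tuple nat => g (nth 0 v 0)).
Proof.
rewrite /recursive1; congr recursive; apply/funext => v.
by rewrite /thead (tnth_nth 0).
Qed.

Lemma recursive_id : recursive1 id.
Proof. by rewrite recursive1E; apply: recursive_nth. Qed.

Lemma recursive_comp1 k g (f : k.-tuple nat -> nat) :
  recursive1 g -> recursive f -> recursive (fun v => g (f v)).
Proof.
move=> rg rf.
have -> : (fun v => g (f v)) = (fun v : k.-tuple nat =>
    (fun u : 1.-tuple nat => g (thead u)) [tuple (fun=> f) i v | i < 1]).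
  by apply/funext => v; rewrite /thead tnth_mktuple.
exact: (recursive_comp rg (fun=> rf)).
Qed.

Lemma recursive_comp2 k g (f1 f2 : k.-tuple nat -> nat) :
  recursive2 g -> recursive f1 -> recursive f2 ->
  recursive (fun v => g (f1 v) (f2 v)).
Proof.
move=> rg r1 r2; pose h (i : 'I_2) := if val i == 0 then f1 else f2.
have -> : (fun v => g (f1 v) (f2 v)) = (fun v : k.-tuple nat =>
    (fun u : 2.-tuple nat => g (nth 0 u 0) (nth 0 u 1))
      [tuple h i v | i < 2]).
  apply/funext => v.
  by rewrite -(tnth_nth 0 _ (@Ordinal 2 0 isT))
             -(tnth_nth 0 _ (@Ordinal 2 1 isT)) !tnth_mktuple.
by apply: (recursive_comp rg) => i; rewrite /h; case: ifP.
Qed.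

(** Primitive recursion in the shape of [iteri], with one parameter; all later recursions, on
    numbers or on coded data, go through it. *)
Lemma recursive_iteri b s : recursive1 b -> recursive3 s ->
  recursive2 (fun n x => iteri n (fun m a => s m a x) (b x)).
Proof.
rewrite recursive1E => rb rs.
by apply: (recursive_prim rb rs) => // v.
Qed.

Lemma recursive_least g f : recursive2 g ->
  (forall x, g (f x) x = 0 /\ forall m, g m x = 0 -> f x <= m) ->
  recursive1 f.
Proof.
move=> rg fP; rewrite recursive1E.
by apply: (recursive_min rg) => v /=; apply: fP.
Qed.

Lemma recursive_const k c : recursive (fun _ : k.-tuple nat => c).
Proof.
elim: c => [|c IH]; first exact: recursive_zero.
by apply: (recursive_comp1 recursive_succ IH).
Qed.

Lemma recursive2_swap g : recursive2 g -> recursive2 (fun x y => g y x).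
Proof. by move=> rg; apply: recursive_comp2 rg _ _; apply: recursive_nth. Qed.

Lemma recursive_addn : recursive2 addn.
Proof.
have -> : addn = (fun n x => iteri n (fun _ a => a.+1) (id x)).
  by apply/funext => n; apply/funext => x; elim: n => //= n <-.
apply: (@recursive_iteri id (fun _ a _ => a.+1)).
  exact: recursive_id.
by apply: recursive_comp1 recursive_succ _; apply: recursive_nth.
Qed.

Lemma recursive_predn : recursive1 predn.
Proof.
have -> : predn = (fun n => iteri n (fun m _ => m) 0) by apply/funext; case.
rewrite recursive1E.
apply: (recursive_comp2 (g := fun n x => iteri n (fun m a => m) 0)
  (f2 := fun=> 0)); try exact: recursive_nth; last exact: recursive_const.
apply: (@recursive_iteri (fun=> 0) (fun m _ _ => m)).
  exact: recursive_const.
exact: recursive_nth.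
Qed.

Lemma recursive_subn : recursive2 subn.
Proof.
have -> : subn = (fun x n => iteri n (fun _ a => a.-1) (id x)).
  apply/funext => x; apply/funext => n; elim: n => [|n IH] /=.
    exact: subn0.
  by rewrite subnS IH.
apply: (@recursive2_swap (fun n x => iteri n (fun=> predn) (id x))).
apply: (@recursive_iteri id (fun _ a _ => a.-1)).
  exact: recursive_id.
by apply: recursive_comp1 recursive_predn _; apply: recursive_nth.
Qed.

Lemma recursive_muln : recursive2 muln.
Proof.
have -> : muln = (fun n x => iteri n (fun _ a => x + a) 0).
  by apply/funext => n; apply/funext => x; elim: n => //= n <-; rewrite mulSn.
apply: (@recursive_iteri (fun=> 0) (fun _ a x => x + a)).
  exact: recursive_const.
by apply: recursive_comp2 recursive_addn _ _; apply: recursive_nth.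
Qed.

(** * Computable functions between coded types *)

Class coded (A : Type) := encode : A -> nat.

Instance coded_nat : coded nat := id.
Instance coded_bool : coded bool := nat_of_bool.
Instance coded_word : coded (seq nat) := CodeSeq.code.
Instance coded_pair A B (cA : coded A) (cB : coded B) : coded (A * B) :=
  fun x => Cantor.to_nat (encode x.1, encode x.2).

(** Computability through codes: [g] agrees with [f] on codes and is free elsewhere, which lets
    [bool] be coded by 0 and 1 alone. *)
Definition cfun A B {cA : coded A} {cB : coded B} (f : A -> B) : Prop :=
  exists2 g, recursive1 g & forall x, encode (f x) = g (encode x).

Lemma cfun_nat f : cfun f <-> recursive1 f.
Proof.
split=> [[g rg fg]|rf]; last by exists f.
by have -> : f = g by apply/funext.
Qed.

Lemma cfun_computable_word phi : cfun phi -> computable_word phi.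
Proof.
move=> [g rg fg]; rewrite /computable_word.
have -> // : CodeSeq.code \o phi \o CodeSeq.decode = g.
by apply/funext => n /=; rewrite -[CodeSeq.code _]/(encode _) fg /encode
  /coded_word CodeSeq.decodeK.
Qed.

(** The triangular numbers: the Cantor pairing lists pairs by diagonals, and [tri n] pairs precede
    the diagonal of sum n. *)
Definition tri n := iteri n (fun i m => i.+1 + m) 0.

Lemma to_natE x y : Cantor.to_nat (x, y) = y + tri (y + x).
Proof. by rewrite /= /tri -[(y + x)%coq_nat]/(y + x); elim: (y + x). Qed.

Lemma leq_tri : {homo tri : m n / m <= n}.
Proof.
by apply: homo_leq => // [l m n|m]; [exact: leq_trans|rewrite /tri /= leq_addl].
Qed.

Lemma recursive_tri : recursive1 tri.
Proof.
rewrite recursive1E.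
apply: (recursive_comp2 (g := fun n x => iteri n (fun m a => m.+1 + a) 0)
  (f2 := fun=> 0)); try exact: recursive_nth; last exact: recursive_const.
apply: (@recursive_iteri (fun=> 0) (fun m a _ => m.+1 + a)).
  exact: recursive_const.
apply: recursive_comp2 recursive_addn _ _; last exact: recursive_nth.
by apply: recursive_comp1 recursive_succ _; apply: recursive_nth.
Qed.

Lemma recursive_to_nat : recursive2 (fun x y => Cantor.to_nat (x, y)).
Proof.
have -> : (fun x y => Cantor.to_nat (x, y)) = (fun x y => y + tri (y + x)).
  by apply/funext => x; apply/funext => y; rewrite to_natE.
apply: recursive_comp2 recursive_addn _ _; first exact: recursive_nth.
apply: recursive_comp1 recursive_tri _.
by apply: recursive_comp2 recursive_addn _ _; apply: recursive_nth.
Qed.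

Lemma of_natE n :
  n = (Cantor.of_nat n).2 + tri ((Cantor.of_nat n).2 + (Cantor.of_nat n).1).
Proof. by rewrite -to_natE -surjective_pairing Cantor.cancel_to_of. Qed.

(** The diagonal of n is found by minimization: it is the least s with n < [tri s.+1]. Both
    projections then follow by subtraction. *)
Lemma recursive_of_nat_sum :
  recursive1 (fun n => (Cantor.of_nat n).2 + (Cantor.of_nat n).1).
Proof.
apply: (@recursive_least (fun s n => n.+1 - tri s.+1)).
  apply: recursive_comp2 recursive_subn _ _.
    by apply: recursive_comp1 recursive_succ _; apply: recursive_nth.
  apply: recursive_comp1 recursive_tri _.
  by apply: recursive_comp1 recursive_succ _; apply: recursive_nth.
move=> n; set x := (Cantor.of_nat n).1; set y := (Cantor.of_nat n).2.
have nE : n = y + tri (y + x) by apply: of_natE.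
split=> [|m /eqP].
  apply/eqP; rewrite subn_eq0 nE /tri iteriS addSn ltnS leq_add2r.
  exact: leq_addr.
rewrite subn_eq0 => nm; rewrite leqNgt; apply/negP => /leq_tri.
move=> /(leq_trans nm); rewrite nE ltnNge leq_addl //.
Qed.

Lemma recursive_of_nat2 : recursive1 (fun n => (Cantor.of_nat n).2).
Proof.
have -> : (fun n => (Cantor.of_nat n).2) = (fun n =>
    n - tri ((Cantor.of_nat n).2 + (Cantor.of_nat n).1)).
  by apply/funext => n; rewrite {2}(of_natE n) addnK.
apply: (recursive_comp2 recursive_subn).
  exact: recursive_id.
exact: (recursive_comp1 recursive_tri recursive_of_nat_sum).
Qed.

Lemma recursive_of_nat1 : recursive1 (fun n => (Cantor.of_nat n).1).
Proof.
have -> : (fun n => (Cantor.of_nat n).1) = (fun n =>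
    ((Cantor.of_nat n).2 + (Cantor.of_nat n).1) - (Cantor.of_nat n).2).
  by apply/funext => n; rewrite addKn.
exact: (recursive_comp2 recursive_subn recursive_of_nat_sum recursive_of_nat2).
Qed.

Section Basic.
Context {X A B C : Type} {cX : coded X} {cA : coded A} {cB : coded B}
  {cC : coded C}.

Lemma cfun_id : cfun (fun x : X => x).
Proof. by exists id => //; apply: recursive_id. Qed.

Lemma cfun_const (a : A) : cfun (fun _ : X => a).
Proof. by exists (fun=> encode a) => //; exact: recursive_const. Qed.

Lemma cfun_comp (g : A -> B) (f : X -> A) :
  cfun g -> cfun f -> cfun (fun x => g (f x)).
Proof.
move=> [g' rg gg'] [f' rf ff']; exists (g' \o f') => [|x].
  exact: (recursive_comp1 rg rf).
by rewrite gg' ff'.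
Qed.

Lemma cfun_pair (f : X -> A) (g : X -> B) :
  cfun f -> cfun g -> cfun (fun x => (f x, g x)).
Proof.
move=> [f' rf ff'] [g' rg gg'].
exists (fun n => Cantor.to_nat (f' n, g' n)) => [|x].
  exact: recursive_comp2 recursive_to_nat rf rg.
by rewrite -ff' -gg'.
Qed.

Lemma cfun_fst (f : X -> A * B) : cfun f -> cfun (fun x => (f x).1).
Proof.
move=> [f' rf ff']; exists (fun n => (Cantor.of_nat (f' n)).1) => [|x].
  exact: (recursive_comp1 recursive_of_nat1 rf).
by rewrite -ff' /encode /coded_pair Cantor.cancel_of_to.
Qed.

Lemma cfun_snd (f : X -> A * B) : cfun f -> cfun (fun x => (f x).2).
Proof.
move=> [f' rf ff']; exists (fun n => (Cantor.of_nat (f' n)).2) => [|x].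
  exact: (recursive_comp1 recursive_of_nat2 rf).
by rewrite -ff' /encode /coded_pair Cantor.cancel_of_to.
Qed.

Lemma cfun_binop (g : nat -> nat -> nat) (f1 f2 : X -> nat) :
  recursive2 g -> cfun f1 -> cfun f2 -> cfun (fun x => g (f1 x) (f2 x)).
Proof.
move=> rg [f1' r1 e1] [f2' r2 e2]; exists (fun n => g (f1' n) (f2' n)) => [|x].
  exact: recursive_comp2 rg r1 r2.
by rewrite -e1 -e2.
Qed.

Lemma cfun_iteri (n : X -> nat) (s : X -> nat -> A -> A) (b : X -> A) :
  cfun n -> cfun (fun y : X * (nat * A) => s y.1 y.2.1 y.2.2) -> cfun b ->
  cfun (fun x => iteri (n x) (s x) (b x)).
Proof.
move=> [n' rn en] [s' rs es] [b' rb eb].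
(* [recursive_iteri] supplies counter, accumulator and parameter separately, while [s'] expects them
   in a single code. *)
pose S m a x := s' (Cantor.to_nat (x, Cantor.to_nat (m, a))).
exists (fun x => iteri (n' x) (fun m a => S m a x) (b' x)) => [|x].
  apply: (recursive_comp2 (g := fun n x => iteri n (fun m a => S m a x) (b' x))
    (f2 := @thead _ nat)) => //; last exact: recursive_proj.
  apply: recursive_iteri rb _; apply: recursive_comp1 rs _.
  apply: (recursive_comp2 recursive_to_nat); first exact: recursive_nth.
  by apply: (recursive_comp2 recursive_to_nat); apply: recursive_nth.
rewrite -en -eb; elim: (n x : nat) => //= m IH.
by rewrite /S -IH -(es (x, (m, _))).
Qed.

End Basic.

Section Control.
Context {X A : Type} {cX : coded X} {cA : coded A}.

Lemma cfun_eqn (f g : X -> nat) : cfun f -> cfun g ->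
  cfun (fun x => f x == g x).
Proof.
move=> cf cg.
(* With truncated subtraction, this is 1 if the two numbers agree and 0 otherwise. *)
suff [h rh eh] : @cfun _ _ cX coded_nat
    (fun x => 1 - ((f x - g x) + (g x - f x))).
  exists h => // x; rewrite -eh /encode /coded_nat /coded_bool.
  rewrite eqn_leq -!subn_eq0.
  by case: (f x - g x) (g x - f x) => [|?] [|?].
apply: (cfun_binop recursive_subn); first exact: cfun_const.
by apply: (cfun_binop recursive_addn); apply: (cfun_binop recursive_subn).
Qed.

Lemma cfun_nat_of_bool (b : X -> bool) : cfun b -> cfun (fun x => b x : nat).
Proof. by []. Qed.

Lemma cfun_if (b : X -> bool) (f g : X -> A) : cfun b -> cfun f -> cfun g ->
  cfun (fun x => if b x then f x else g x).
Proof.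
move=> [b' rb eb] [f' rf ef] [g' rg eg].
exists (fun n => b' n * f' n + (1 - b' n) * g' n) => [|x].
  apply: (recursive_comp2 recursive_addn);
    apply: (recursive_comp2 recursive_muln) => //.
  apply: (recursive_comp2 recursive_subn) => //; exact: recursive_const.
rewrite -eb -ef -eg /encode /coded_bool; case: (b x) => /=.
  by rewrite mul1n subnn mul0n addn0.
by rewrite mul0n subn0 mul1n add0n.
Qed.

End Control.

Lemma cfun_succn X {cX : coded X} (f : X -> nat) :
  cfun f -> cfun (fun x => (f x).+1).
Proof.
move=> cf; apply: (cfun_comp (g := succn)) cf.
exact/cfun_nat/recursive_succ.
Qed.

Lemma cfun_predn X {cX : coded X} (f : X -> nat) :
  cfun f -> cfun (fun x => (f x).-1).
Proof.
move=> cf; apply: (cfun_comp (g := predn)) cf.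
exact/cfun_nat/recursive_predn.
Qed.

Lemma cfun_addn X {cX : coded X} (f g : X -> nat) :
  cfun f -> cfun g -> cfun (fun x => f x + g x).
Proof. exact: cfun_binop recursive_addn. Qed.

Lemma cfun_subn X {cX : coded X} (f g : X -> nat) :
  cfun f -> cfun g -> cfun (fun x => f x - g x).
Proof. exact: cfun_binop recursive_subn. Qed.

Lemma cfun_muln X {cX : coded X} (f g : X -> nat) :
  cfun f -> cfun g -> cfun (fun x => f x * g x).
Proof. exact: cfun_binop recursive_muln. Qed.

Lemma cfun_leq X {cX : coded X} (f g : X -> nat) :
  cfun f -> cfun g -> cfun (fun x => f x <= g x).
Proof.
by move=> cf cg; apply: cfun_eqn (cfun_subn cf cg) (cfun_const 0).
Qed.

Lemma cfun_negb X {cX : coded X} (b : X -> bool) :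
  cfun b -> cfun (fun x => ~~ b x).
Proof. by move=> cb; apply: cfun_if cb (cfun_const _) (cfun_const _). Qed.

Lemma cfun_andb X {cX : coded X} (b c : X -> bool) :
  cfun b -> cfun c -> cfun (fun x => b x && c x).
Proof. by move=> cb cc; apply: cfun_if cb cc (cfun_const _). Qed.

Lemma cfun_orb X {cX : coded X} (b c : X -> bool) :
  cfun b -> cfun c -> cfun (fun x => b x || c x).
Proof. by move=> cb cc; apply: cfun_if cb (cfun_const _) cc. Qed.

Lemma cfun_eqb X {cX : coded X} (b c : X -> bool) :
  cfun b -> cfun c -> cfun (fun x => b x == c x).
Proof.
move=> cb cc.
have -> : (fun x => b x == c x) = (fun x => if b x then c x else ~~ c x).
  by apply/funext => x; case: (b x) (c x) => -[].
exact: cfun_if cb cc (cfun_negb cc).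
Qed.

Lemma cfun_odd X {cX : coded X} (f : X -> nat) :
  cfun f -> cfun (fun x => odd (f x)).
Proof.
have -> : (fun x => odd (f x)) = (fun x => iteri (f x) (fun _ => negb) false).
  by apply/funext => x; elim: (f x) => //= n ->.
move=> cf; apply: cfun_iteri cf _ (cfun_const _).
exact/cfun_negb/cfun_snd/cfun_snd/cfun_id.
Qed.

Lemma cfun_double X {cX : coded X} (f : X -> nat) :
  cfun f -> cfun (fun x => (f x).*2).
Proof.
move=> cf; have -> : (fun x => (f x).*2) = (fun x => f x + f x).
  by apply/funext => x; rewrite addnn.
exact: cfun_addn.
Qed.

Lemma cfun_half X {cX : coded X} (f : X -> nat) :
  cfun f -> cfun (fun x => (f x)./2).
Proof.
have -> : (fun x => (f x)./2) = (fun x => iteri (f x) (fun n h => odd n + h) 0).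
  apply/funext => x; elim: (f x) => //= n <-; exact: uphalf_half.
move=> cf; apply: cfun_iteri cf _ (cfun_const _).
apply: cfun_addn (cfun_snd (cfun_snd cfun_id)).
exact/cfun_nat_of_bool/cfun_odd/cfun_fst/cfun_snd/cfun_id.
Qed.

Lemma cfun_exp2n X {cX : coded X} (f : X -> nat) :
  cfun f -> cfun (fun x => 2 ^ f x).
Proof.
have -> : (fun x => 2 ^ f x) = (fun x => iteri (f x) (fun _ => double) 1).
  by apply/funext => x; elim: (f x) => //= n <-; rewrite expnS mul2n.
move=> cf; apply: cfun_iteri cf _ (cfun_const _).
exact/cfun_double/cfun_snd/cfun_snd/cfun_id.
Qed.

Lemma cfun_find X {cX : coded X} (P : X -> pred nat) (f : X -> nat) :
  cfun f -> cfun (fun y : X * nat => P y.1 y.2) ->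
  cfun (fun x => find (P x) (iota 0 (f x))).
Proof.
move=> cf cP.
(* After m rounds the accumulator is the first hit below m, and m itself if there is none. *)
have -> : (fun x => find (P x) (iota 0 (f x))) = (fun x =>
    iteri (f x) (fun m a => if a < m then a else if P x m then m else m.+1) 0).
  apply/funext => x; elim: (f x) => // n IH; rewrite iteriS -IH.
  have -> : iota 0 n.+1 = iota 0 n ++ [:: n] by rewrite -addn1 iotaD.
  rewrite find_cat has_find size_iota /=.
  by case: ifP => // _; case: (P x n); rewrite ?addn0 ?addn1.
apply: cfun_iteri cf _ (cfun_const _).
apply: cfun_if; [|exact: cfun_snd (cfun_snd cfun_id)|].
  apply: cfun_leq (cfun_succn (cfun_snd (cfun_snd cfun_id))) _.
  exact: cfun_fst (cfun_snd cfun_id).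
apply: cfun_if; last exact: cfun_succn (cfun_fst (cfun_snd cfun_id)).
  apply: cfun_comp cP (cfun_pair (cfun_fst cfun_id) _).
  exact: cfun_fst (cfun_snd cfun_id).
exact: cfun_fst (cfun_snd cfun_id).
Qed.

Lemma cfun_has X {cX : coded X} (P : X -> pred nat) (f : X -> nat) :
  cfun f -> cfun (fun y : X * nat => P y.1 y.2) ->
  cfun (fun x => has (P x) (iota 0 (f x))).
Proof.
move=> cf cP.
have -> : (fun x => has (P x) (iota 0 (f x))) =
    (fun x => find (P x) (iota 0 (f x)) < f x).
  by apply/funext => x; rewrite has_find size_iota.
exact: cfun_leq (cfun_succn (cfun_find cf cP)) cf.
Qed.

(** * Words and their codes *)

Lemma cfun_code X {cX : coded X} (u : X -> seq nat) :
  cfun u -> cfun (fun x => CodeSeq.code (u x)).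
Proof. by []. Qed.

Lemma cfun_decode X {cX : coded X} (f : X -> nat) :
  cfun f -> cfun (fun x => CodeSeq.decode (f x)).
Proof.
move=> [f' rf ef]; exists f' => // x.
by rewrite -ef /encode /coded_word CodeSeq.decodeK.
Qed.

Lemma cfun_cons X {cX : coded X} (f : X -> nat) (u : X -> seq nat) :
  cfun f -> cfun u -> cfun (fun x => f x :: u x).
Proof.
move=> cf cu.
have [h rh eh] : @cfun _ _ cX coded_nat
    (fun x => 2 ^ f x * (CodeSeq.code (u x)).*2.+1).
  apply: cfun_muln (cfun_exp2n cf) _.
  exact: cfun_succn (cfun_double (cfun_code cu)).
by exists h.
Qed.

Lemma code_cons n u : CodeSeq.code (n :: u) = 2 ^ n * (CodeSeq.code u).*2.+1.
Proof. by []. Qed.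

Lemma cfun_iter_half X {cX : coded X} (f g : X -> nat) :
  cfun f -> cfun g -> cfun (fun x => iter (f x) half (g x)).
Proof.
move=> cf cg.
have -> : (fun x => iter (f x) half (g x)) =
    (fun x => iteri (f x) (fun _ => half) (g x)).
  by apply/funext => x; elim: (f x) => //= n ->.
apply: cfun_iteri cf _ cg.
exact/cfun_half/cfun_snd/cfun_snd/cfun_id.
Qed.

Lemma find_iota (P : pred nat) n m :
  m < n -> P m -> (forall k, k < m -> ~~ P k) -> find P (iota 0 n) = m.
Proof.
move=> mn Pm nP; rewrite -(subnKC (ltnW mn)) iotaD find_cat has_find size_iota.
have -> : find P (iota 0 m) = m.
  rewrite -[RHS](size_iota 0); apply/hasNfind/hasPn => k.
  by rewrite mem_iota => /nP.
by rewrite ltnn -(prednK (_ : 0 < n - m)) ?subn_gt0 //= add0n Pm addn0.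
Qed.

Lemma iter_half_exp2n m k x : iter m half (2 ^ (m + k) * x) = 2 ^ k * x.
Proof.
by elim: m => // m IH; rewrite iterSr addSn expnS -mulnA mul2n doubleK.
Qed.

(** The head is the exponent of 2 in the code of a nonempty word, found by halving until the result
    is odd. The code bounds the search because n < 2 ^ n; the empty word has code 0, and the empty
    search returns the default head. *)
Lemma head_code u :
  head 0 u = find (fun n => odd (iter n half (CodeSeq.code u)))
                  (iota 0 (CodeSeq.code u)).
Proof.
case: u => // n u; rewrite code_cons [LHS]/=.
set P := fun m => odd (iter m half (2 ^ n * (CodeSeq.code u).*2.+1)).
have oddP k : k <= n -> P k = (n - k == 0).
  move=> kn; rewrite /P -{1}(subnKC kn) iter_half_exp2n oddM oddX /= odd_double.
  by rewrite orbF andbT.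
apply/esym/find_iota => [||k kn].
- by apply: leq_trans (ltn_expl n (ltnSn 1)) _; apply: leq_pmulr.
- by rewrite oddP // subnn.
- by rewrite oddP 1?ltnW // subn_eq0 -ltnNge.
Qed.

Lemma behead_code u :
  behead u = CodeSeq.decode (iter (head 0 u) half (CodeSeq.code u))./2.
Proof.
case: u => // n u; have := iter_half_exp2n n 0 (CodeSeq.code u).*2.+1.
rewrite addn0 mul1n code_cons [head _ _]/= => -> /=.
by rewrite uphalf_double CodeSeq.codeK.
Qed.

Lemma cfun_head X {cX : coded X} (u : X -> seq nat) :
  cfun u -> cfun (fun x => head 0 (u x)).
Proof.
move=> cu; under eq_fun do rewrite head_code.
apply: (cfun_find (P := fun x n => odd (iter n half (CodeSeq.code (u x)))))
  => //.
apply: cfun_odd (cfun_iter_half (cfun_snd cfun_id) _).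
exact: cfun_comp (cfun_code cu) (cfun_fst cfun_id).
Qed.

Lemma cfun_behead X {cX : coded X} (u : X -> seq nat) :
  cfun u -> cfun (fun x => behead (u x)).
Proof.
move=> cu; under eq_fun do rewrite behead_code.
exact: cfun_decode (cfun_half (cfun_iter_half (cfun_head cu) (cfun_code cu))).
Qed.

Lemma cfun_drop X {cX : coded X} (f : X -> nat) (u : X -> seq nat) :
  cfun f -> cfun u -> cfun (fun x => drop (f x) (u x)).
Proof.
move=> cf cu.
have -> : (fun x => drop (f x) (u x)) =
    (fun x => iteri (f x) (fun _ => behead) (u x)).
  apply/funext => x; elim: (f x) => [|n IH /=]; first by rewrite drop0.
  by rewrite -IH -add1n -drop_drop drop1.
apply: cfun_iteri cf _ cu.
exact: cfun_behead (cfun_snd (cfun_snd cfun_id)).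
Qed.

Lemma cfun_nth X {cX : coded X} (u : X -> seq nat) (f : X -> nat) :
  cfun u -> cfun f -> cfun (fun x => nth 0 (u x) (f x)).
Proof.
move=> cu cf; have -> : (fun x => nth 0 (u x) (f x)) =
    (fun x => head 0 (drop (f x) (u x))).
  by apply/funext => x; rewrite -nth0 nth_drop addn0.
exact: cfun_head (cfun_drop cf cu).
Qed.

Lemma cfun_eqw X {cX : coded X} (u v : X -> seq nat) :
  cfun u -> cfun v -> cfun (fun x => u x == v x).
Proof.
move=> cu cv; have -> : (fun x => u x == v x) =
    (fun x => CodeSeq.code (u x) == CodeSeq.code (v x)).
  by apply/funext => x; rewrite (can_eq CodeSeq.codeK).
exact: cfun_eqn (cfun_code cu) (cfun_code cv).
Qed.

Lemma size_code u : size u <= CodeSeq.code u.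
Proof.
elim: u => // n u IH; rewrite code_cons /= -[(size u).+1]mul1n.
by apply: leq_mul; rewrite ?expn_gt0 // ltnS (leq_trans IH) // -addnn leq_addr.
Qed.

Lemma cfun_size X {cX : coded X} (u : X -> seq nat) :
  cfun u -> cfun (fun x => size (u x)).
Proof.
move=> cu; have -> : (fun x => size (u x)) = (fun x =>
    find (fun n => drop n (u x) == [::]) (iota 0 (CodeSeq.code (u x)).+1)).
  apply/funext => x; apply/esym/find_iota; first by rewrite ltnS size_code.
    by rewrite drop_size.
  by move=> k; rewrite -subn_gt0 -size_drop lt0n; apply: contraNN => /eqP ->.
apply: cfun_find (cfun_succn (cfun_code cu)) _; apply: cfun_eqw (cfun_const _).
exact: cfun_drop (cfun_snd cfun_id) (cfun_comp cu (cfun_fst cfun_id)).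
Qed.

Lemma cfun_mkseq X {cX : coded X} (F : X -> nat -> nat) (f : X -> nat) :
  cfun f -> cfun (fun y : X * nat => F y.1 y.2) ->
  cfun (fun x => mkseq (F x) (f x)).
Proof.
(* Letters are consed in front, so the word is built from its end: round n adds the letter at
   [f x - n.+1]. *)
move=> cf cF; have -> : (fun x => mkseq (F x) (f x)) = (fun x =>
    iteri (f x) (fun n u => F x (f x - n.+1) :: u) [::]).
  apply/funext => x; rewrite /mkseq.
  suff H m : m <= f x -> iteri m (fun n u => F x (f x - n.+1) :: u) [::] =
      [seq F x i | i <- iota (f x - m) m] by rewrite H // subnn.
  elim: m => //= m IH mf; rewrite IH 1?ltnW //; congr (_ :: map _ (iota _ _)).
  by rewrite subnSK.
apply: (cfun_iteri cf _ (cfun_const _)); apply: cfun_cons; last first.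
  exact: cfun_snd (cfun_snd cfun_id).
apply: (cfun_comp (f := fun y => (y.1, f y.1 - y.2.1.+1)) cF).
apply: cfun_pair (cfun_fst cfun_id) _.
apply: cfun_subn (cfun_succn (cfun_fst (cfun_snd cfun_id))).
exact: cfun_comp cf (cfun_fst cfun_id).
Qed.

(** * Automatic proofs of computability, extensible through [cfun_user] *)

Ltac cfun_user := fail.

Ltac cfun_step :=
  lazymatch goal with
  | |- cfun (fun _ => ?c) => refine (cfun_const c)
  | |- cfun (fun x => x) => refine cfun_id
  | |- cfun fst => refine (cfun_fst cfun_id)
  | |- cfun snd => refine (cfun_snd cfun_id)
  | |- cfun (fun x => (@?f x, @?g x)) =>
      refine (cfun_pair (f := f) (g := g) _ _)
  | |- cfun (fun x => (@?f x).1) => refine (cfun_fst (f := f) _)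
  | |- cfun (fun x => (@?f x).2) => refine (cfun_snd (f := f) _)
  | |- cfun (fun x => nat_of_bool (@?f x)) =>
      refine (cfun_nat_of_bool (b := f) _)
  | |- cfun (fun x => if _ then _ else _) => refine (cfun_if _ _ _)
  | |- cfun (fun x => iteri (@?n x) (@?s x) (@?b x)) =>
      refine (cfun_iteri (n := n) (s := s) (b := b) _ _ _)
  | |- cfun (fun x => S (@?f x)) => refine (cfun_succn (f := f) _)
  | |- cfun (fun x => predn (@?f x)) => refine (cfun_predn (f := f) _)
  | |- cfun (fun x => addn (@?f x) (@?g x)) =>
      refine (cfun_addn (f := f) (g := g) _ _)
  | |- cfun (fun x => subn (@?f x) (@?g x)) =>
      refine (cfun_subn (f := f) (g := g) _ _)
  | |- cfun (fun x => leq (@?f x) (@?g x)) =>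
      refine (cfun_leq (f := f) (g := g) _ _)
  | |- cfun (fun x => eq_op (@?f x) (@?g x)) =>
      first [ refine (cfun_eqn (f := f) (g := g) _ _)
            | refine (cfun_eqb (b := f) (c := g) _ _)
            | refine (cfun_eqw (u := f) (v := g) _ _) ]
  | |- cfun (fun x => negb (@?f x)) => refine (cfun_negb (b := f) _)
  | |- cfun (fun x => andb (@?f x) (@?g x)) =>
      refine (cfun_andb (b := f) (c := g) _ _)
  | |- cfun (fun x => orb (@?f x) (@?g x)) =>
      refine (cfun_orb (b := f) (c := g) _ _)
  | |- cfun (fun x => odd (@?f x)) => refine (cfun_odd (f := f) _)
  | |- cfun (fun x => double (@?f x)) => refine (cfun_double (f := f) _)
  | |- cfun (fun x => half (@?f x)) => refine (cfun_half (f := f) _)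
  | |- cfun (fun x => find (@?P x) (iota 0 (@?f x))) =>
      refine (cfun_find (P := P) (f := f) _ _)
  | |- cfun (fun x => has (@?P x) (iota 0 (@?f x))) =>
      refine (cfun_has (P := P) (f := f) _ _)
  | |- cfun (fun x => CodeSeq.code (@?f x)) => refine (cfun_code (u := f) _)
  | |- cfun (fun x => CodeSeq.decode (@?f x)) =>
      refine (cfun_decode (f := f) _)
  | |- cfun (fun x => cons (@?f x) (@?u x)) =>
      refine (cfun_cons (f := f) (u := u) _ _)
  | |- cfun (fun x => nth 0 (@?u x) (@?f x)) =>
      refine (cfun_nth (u := u) (f := f) _ _)
  | |- cfun (fun x => size (@?u x)) => refine (cfun_size (u := u) _)
  | |- cfun (fun x => mkseq (@?F x) (@?f x)) =>
      refine (cfun_mkseq (F := F) (f := f) _ _)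
  | H : cfun ?g |- cfun (fun x => ?g (@?f x)) =>
      refine (cfun_comp (f := f) H _)
  | H : cfun (fun y => ?g y.1 y.2) |- cfun (fun x => ?g (@?f1 x) (@?f2 x)) =>
      refine (cfun_comp (f := fun x => (f1 x, f2 x)) H _)
  | |- _ => cfun_user
  end; cbv beta.

Ltac cfun_auto := cbv beta; repeat cfun_step.

Lemma cfun_to_nat X {cX : coded X} (f g : X -> nat) :
  cfun f -> cfun g -> cfun (fun x => Cantor.to_nat (f x, g x)).
Proof. exact: cfun_binop recursive_to_nat. Qed.

Lemma cfun_of_nat X {cX : coded X} (f : X -> nat) :
  cfun f -> cfun (fun x => Cantor.of_nat (f x)).
Proof.
move=> [g rg fg]; exists g => // x; rewrite -fg /encode /coded_pair.
by rewrite -surjective_pairing Cantor.cancel_to_of.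
Qed.

Lemma cfun_take X {cX : coded X} (f : X -> nat) (u : X -> seq nat) :
  cfun f -> cfun u -> cfun (fun x => take (f x) (u x)).
Proof.
move=> cf cu; have -> : (fun x => take (f x) (u x)) = (fun x =>
    mkseq (nth 0 (u x)) (if f x < size (u x) then f x else size (u x))).
  apply/funext => x; apply: (@eq_from_nth _ 0).
    by rewrite size_mkseq size_take_min.
  move=> i; rewrite size_take_min => ilt; rewrite nth_mkseq ?nth_take //.
  by apply: leq_trans ilt _; rewrite geq_minl.
by cfun_auto.
Qed.

Lemma cfun_prefix X {cX : coded X} (u v : X -> seq nat) :
  cfun u -> cfun v -> cfun (fun x => prefix (u x) (v x)).
Proof.
move=> cu cv; under eq_fun do rewrite prefixE.
by apply: cfun_eqw (cfun_take _ _) _ => //; cfun_auto.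
Qed.

(** * Searching for values *)

(* Partial values are coded by natural numbers: [0] is undefined and [v.+1] is
   the value [v]. *)
Definition partial_value (h : nat) (v : nat) : Prop := h = 0 \/ h = v.+1.

Definition first (h : nat -> nat) (b : nat) : nat :=
  if has (fun n => h n != 0) (iota 0 b)
  then h (find (fun n => h n != 0) (iota 0 b)) else 0.

Definition collect (h : nat -> nat) (b : nat) : seq nat :=
  mkseq (fun k => (h k).-1) (find (fun k => h k == 0) (iota 0 b)).

Lemma cfun_first X {cX : coded X} (h : X -> nat -> nat) (b : X -> nat) :
  cfun b -> cfun (fun y : X * nat => h y.1 y.2) ->
  cfun (fun x => first (h x) (b x)).
Proof. by move=> cb ch; rewrite /first; cfun_auto. Qed.

Lemma cfun_collect X {cX : coded X} (h : X -> nat -> nat) (b : X -> nat) :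
  cfun b -> cfun (fun y : X * nat => h y.1 y.2) ->
  cfun (fun x => collect (h x) (b x)).
Proof. by move=> cb ch; rewrite /collect; cfun_auto. Qed.

Ltac cfun_user ::=
  lazymatch goal with
  | |- cfun (fun x => Cantor.to_nat (@?f x, @?g x)) =>
      refine (cfun_to_nat (f := f) (g := g) _ _)
  | |- cfun (fun x => Cantor.of_nat (@?f x)) =>
      refine (cfun_of_nat (f := f) _)
  | |- cfun (fun x => take (@?f x) (@?u x)) =>
      refine (cfun_take (f := f) (u := u) _ _)
  | |- cfun (fun x => prefix (@?u x) (@?v x)) =>
      refine (cfun_prefix (u := u) (v := v) _ _)
  | |- cfun (fun x => first (@?h x) (@?b x)) =>
      refine (cfun_first (h := h) (b := b) _ _)
  | |- cfun (fun x => collect (@?h x) (@?b x)) =>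
      refine (cfun_collect (h := h) (b := b) _ _)
  end.

Lemma firstN0 h b : first h b != 0 <-> exists2 n, n < b & h n != 0.
Proof.
rewrite /first; split=> [|[n nb hn]].
  case: ifP => // /hasP[n]; rewrite mem_iota => nb hn _; by exists n.
have hh : has (fun n => h n != 0) (iota 0 b).
  by apply/hasP; exists n; rewrite ?mem_iota.
rewrite hh; have := nth_find 0 hh.
by rewrite nth_iota ?add0n //; rewrite has_find size_iota in hh.
Qed.

Lemma first_value h b v : (forall n, partial_value (h n) v) ->
  partial_value (first h b) v.
Proof. by move=> hv; rewrite /first; case: ifP => // _; left. Qed.

(** A value once found survives a larger bound; this makes the word functions obtained from searches
    monotone. *)
Lemma first_stable h h' b b' : b <= b' -> (forall n, n < b -> h' n = h n) ->
  first h b != 0 -> first h' b' = first h b.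
Proof.
move=> bb hh /firstN0[n nb hn].
have hb : has (fun n => h n != 0) (iota 0 b).
  by apply/hasP; exists n; rewrite ?mem_iota.
have eh : {in iota 0 b, (fun n => h' n != 0) =1 (fun n => h n != 0)}.
  by move=> k; rewrite mem_iota /= => kb; rewrite hh.
rewrite /first -(subnKC bb) iotaD has_cat find_cat.
rewrite (eq_in_has eh) hb (eq_in_find eh) /= hh //.
by rewrite has_find size_iota in hb.
Qed.

Lemma collect_size h b m : m <= b -> (forall k, k < m -> h k != 0) ->
  m <= size (collect h b).
Proof.
move=> mb hm; rewrite size_mkseq leqNgt; apply/negP => lt.
have sz : find (fun k => h k == 0) (iota 0 b) < b by apply: leq_trans lt mb.
have hh : has (fun k => h k == 0) (iota 0 b) by rewrite has_find size_iota.
by have := nth_find 0 hh; rewrite nth_iota // add0n (negPf (hm _ lt)).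
Qed.

Lemma collect_defined h b k : k < size (collect h b) -> h k != 0.
Proof.
rewrite size_mkseq => lt; have := before_find 0 lt.
rewrite nth_iota ?add0n => [->//|].
by apply: leq_trans lt _; rewrite -[leqRHS](size_iota 0); apply: find_size.
Qed.

Lemma nth_collect h b k : k < size (collect h b) ->
  nth 0 (collect h b) k = (h k).-1.
Proof. by rewrite /collect size_mkseq => lt; rewrite nth_mkseq. Qed.

Lemma collectE h b (r : baire) : (forall k, partial_value (h k) (r k)) ->
  collect h b = mkseq r (size (collect h b)).
Proof.
move=> hr; apply: (@eq_from_nth _ 0); first by rewrite size_mkseq.
move=> k lt; rewrite nth_mkseq // nth_collect //.
by have := collect_defined lt; case: (hr k) => ->.
Qed.

Lemma collect_prefix h h' b b' : b <= b' ->
  (forall k, h k != 0 -> h' k = h k) -> prefix (collect h b) (collect h' b').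
Proof.
move=> bb hh.
have sz : size (collect h b) <= size (collect h' b').
  apply: collect_size => [|k /collect_defined hk]; last by rewrite hh.
  rewrite size_mkseq; apply: leq_trans bb.
  by rewrite -[leqRHS](size_iota 0); apply: find_size.
rewrite prefixE; apply/eqP/(@eq_from_nth _ 0); first exact: size_takel.
rewrite size_takel // => k lt; rewrite nth_take // !nth_collect //.
  by rewrite hh // (collect_defined lt).
exact: leq_trans sz.
Qed.

Lemma take_mkseq (p : baire) m n : take m (mkseq p n) = mkseq p (minn m n).
Proof. by rewrite /mkseq -map_take take_iota. Qed.

(** The form in which the maps of a reduction are given: a prefix may leave a letter open, but no
    two prefixes may give it different values. *)
Definition search_fun (h : seq nat -> nat -> nat) : baire -> set baire :=
  fun p => [set r | forall k,
    (forall n, partial_value (h (mkseq p n) k) (r k)) /\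
    exists n, h (mkseq p n) k != 0].

Lemma search_fun_fun h : is_fun (search_fun h).
Proof.
move=> p r s hr hs; apply/funext => k.
have [h1 [n hn]] := hr k; have [/(_ n) h2 _] := hs k.
by case: (h1 n) h2 hn => -> [] // [].
Qed.

(* Since [h] need not be monotone, all the prefixes of a word are searched. *)
Lemma search_fun_computable h :
  cfun (fun y : seq nat * nat => h y.1 y.2) -> computable (search_fun h).
Proof.
move=> ch; pose H w k := first (fun n => h (take n w) k) (size w).+1.
pose phi w := collect (H w) (size w).
exists phi; split.
- apply: cfun_computable_word; apply: cfun_collect.
    exact: cfun_size cfun_id.
  by apply: cfun_first; cfun_auto.
- move=> v w pvw; apply: collect_prefix; first exact: size_prefix.
  move=> k; apply: first_stable; first by rewrite ltnS size_prefix.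
  by move=> n; rewrite ltnS => nv; case/prefixP: pvw => u ->; rewrite takel_cat.
- move=> p r hr; split=> [n|m].
    apply: collectE => k; apply: first_value => i.
    by rewrite take_mkseq; case: (hr k).
  have {}hr k : exists N, forall n, N <= n -> H (mkseq p n) k != 0.
    have [_ [N hN]] := hr k; exists N => n Nn; apply/firstN0; exists N.
      by rewrite size_mkseq ltnS.
    by rewrite take_mkseq (minn_idPl Nn).
  (* A common threshold for the finitely many positions below m. *)
  have [N hN] : exists N, forall n, N <= n ->
      forall k, k < m -> H (mkseq p n) k != 0.
    elim: m => [|m [N hN]]; first by exists 0.
    have [N' hN'] := hr m; exists (maxn N N') => n.
    rewrite geq_max => /andP[n1 n2] k.
    by rewrite ltnS leq_eqVlt => /predU1P[->|]; [exact: hN'|exact: hN].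
  exists (maxn m N); apply: collect_size; first by rewrite size_mkseq leq_maxl.
  by apply: hN; rewrite leq_maxr.
Qed.

(** The letter at n is answered on words of length exactly n, the length at which [g] is known to be
    right. *)
Lemma search_fun_total (k : baire -> baire) (g : seq nat -> nat -> nat) :
  (forall p n, k p n = g (mkseq p n) n) ->
  forall p, search_fun (fun u n => if size u == n then (g u n).+1 else 0)
    p (k p).
Proof.
move=> kg p n; split=> [m|]; last by exists n; rewrite size_mkseq eqxx.
rewrite size_mkseq; case: eqP => [->|_]; last by left.
by rewrite -kg; right.
Qed.

(** The domain conditions of both compositions come for free: every point has a name, and a name has
    only one point. *)
Lemma realizer_versionE (X Y : repspace) (f : problem X Y) p r :
  realizer_version f p r <->
  exists x y, [/\ @name X p x, f x y & @name Y r y].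
Proof.
split=> [[_ [y [_ [x px fxy] ry]]]|[x [y [px fxy ry]]]]; first by exists x, y.
have sur z : dom (fun y => [set r | @name Y r y]) z by apply: name_surj.
split=> [y' _ //|]; exists y => //; split; last by exists x.
by move=> x' px'; rewrite (name_fun px' px); exists y.
Qed.

Lemma realizesE (X Y : repspace) (F : baire -> set baire) (f : problem X Y) :
  realizes F f <-> forall p, dom (realizer_version f) p ->
    exists2 r, F p r & realizer_version f p r.
Proof.
have E p r : (exists2 y, @name Y r y & mcomp f (@name X) p y) <->
    realizer_version f p r.
  split=> [[y ry fy]|[_ [y fy ry]]]; last by exists y.
  split; last by exists y.
  by move=> z _; apply: name_surj.
split=> H p [r pr].
  have [|r' Fr'] := H p; last by move/E; exists r'.
  by have /E[y _ fy] := pr; exists y.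
have [r' rr'] := name_surj r.
have [|s Fs] := H p; last by move/E; exists s.
by exists r'; apply/E; exists r.
Qed.

Lemma sW_le_search (X Y Z W : repspace) (f : problem X Y) (g : problem Z W)
    (k : baire -> baire) (gk h : seq nat -> nat -> nat) :
  (forall p n, k p n = gk (mkseq p n) n) ->
  cfun (fun y : seq nat * nat => gk y.1 y.2) ->
  cfun (fun y : seq nat * nat => h y.1 y.2) ->
  (forall p, dom (realizer_version f) p ->
    dom (realizer_version g) (k p) /\
    forall r, realizer_version g (k p) r ->
      exists2 s, search_fun h r s & realizer_version f p s) ->
  sW_le f g.
Proof.
move=> kE cgk ch fg.
pose hk u n := if size u == n then (gk u n).+1 else 0.
have kP := search_fun_total kE.
exists (search_fun h), (search_fun hk); split.
- by split; [exact: search_fun_fun|exact: search_fun_computable].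
- split; first exact: search_fun_fun.
  by apply: search_fun_computable; rewrite /hk; cfun_auto.
move=> G Gf /realizesE Gg; apply/realizesE => p /fg[/Gg[r Gr gr]].
move=> /(_ r gr)[s hs fs]; exists s => //.
have Kp q : search_fun hk p q -> q = k p.
  by move/search_fun_fun; apply; apply: kP.
(* Since [G] is single-valued and the preprocessing yields only [k p], the domain condition of the
   outer composition concerns [r] alone. *)
have GKr r' : mcomp G (search_fun hk) p r' -> r' = r.
  by move=> [_ [q /Kp-> Gr']]; apply: Gf Gr' Gr.
split; first by move=> r' /GKr ->; exists s.
exists r => //; split; first by move=> q /Kp->; exists r.
by exists (k p).
Qed.

(** * The loop *)

Lemma leq_half n : n./2 <= n.
Proof. by rewrite leq_half_double -addnn -addnS leq_addr. Qed.


Definition even_part (s : baire) : baire := fun n => s n.*2.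
Definition odd_part (s : baire) : baire := fun n => s n.*2.+1.

Lemma even_pair q p : even_part (pair_baire q p) = q.
Proof.
by apply/funext => n; rewrite /even_part /pair_baire odd_double doubleK.
Qed.

Lemma odd_pair q p : odd_part (pair_baire q p) = p.
Proof.
apply/funext => n.
by rewrite /odd_part /pair_baire /= odd_double /= uphalf_double.
Qed.

Lemma pair_parts s : pair_baire (even_part s) (odd_part s) = s.
Proof.
apply/funext => n; rewrite /pair_baire /even_part /odd_part.
by case: ifP => on; rewrite -[in RHS](odd_double_half n) on.
Qed.

(** The first clause stems from the domain of the composition: the program converges on every
    answer, not just on the one taken. It later provides convergence on any answer found to be
    correct. *)
Lemma loop_bodyE f s s' : loop_body f s s' <->
  (forall r, f (odd_part s) r -> dom (Phi (even_part s)) r) /\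
  exists2 r, f (odd_part s) r & Phi (even_part s) r s'.
Proof.
split.
  move=> [h [t [q [p [r [sE tE fpr]]]] [q' [r' [tE' Pr']]]]].
  have eqq : q = q' by rewrite -(even_pair q r) -tE tE' even_pair.
  have err : r = r' by rewrite -(odd_pair q r) -tE tE' odd_pair.
  rewrite sE odd_pair even_pair eqq; split=> [r2 fr2|]; last first.
    by exists r => //; rewrite err.
  have [|s2 [q2 [p2 [e2 P2]]]] := h (pair_baire q r2); first by exists q, p, r2.
  exists s2; suff [-> ->] : q' = q2 /\ r2 = p2 by [].
  by rewrite -eqq -(even_pair q r2) -[X in _ /\ X = _](odd_pair q r2) e2
    even_pair odd_pair.
move=> [h [r fr Pr]]; split.
  move=> t [q [p [r2 [sE -> fr2]]]]; move: h; rewrite sE even_pair odd_pair.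
  by move=> /(_ r2 fr2)[s2 P2]; exists s2, q, r2.
exists (pair_baire (even_part s) r).
  by exists (even_part s), (odd_part s), r; rewrite pair_parts.
by exists (even_part s), r.
Qed.

(** * A problem reduces to its loop *)

Lemma mkseq_zero n : mkseq (fun=> 0) n = nseq n 0.
Proof.
apply: (@eq_from_nth _ 0) => [|i]; rewrite size_mkseq ?size_nseq // => lt.
by rewrite nth_mkseq // nth_nseq lt.
Qed.

Section Quine.
Variable p0 : baire.
Implicit Type r : baire.

(* The letter at [m] of the sequence [quine r], given the word [u] of its
   letters below [m].  On zero words, [quine r] describes a function with value
   [pair_baire (quine r) p0]; this is well founded since a word is not longer
   than its code.  On the other words, it hides [r]. *)
Definition quine_letter r (m : nat) (u : seq nat) : nat :=
  let w := CodeSeq.decode m in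
  if w == nseq (size w) 0 then
    CodeSeq.code (mkseq (fun i => if odd i then p0 i./2 else nth 0 u i./2)
                        (size w))
  else r (nth 0 w 0).-1.

Definition quine_word r n : seq nat :=
  iteri n (fun m u => rcons u (quine_letter r m u)) [::].

Definition quine r : baire := fun n => quine_letter r n (quine_word r n).

Lemma quine_wordE r n : quine_word r n = mkseq (quine r) n.
Proof. by elim: n => // n IH; rewrite mkseqS -IH. Qed.

Lemma quineE r n : quine r n = quine_letter r n (mkseq (quine r) n).
Proof. by rewrite -quine_wordE. Qed.

Lemma head_decode n : nth 0 (CodeSeq.decode n) 0 <= n.
Proof.
case: (CodeSeq.decode n) (CodeSeq.gtn_decode n) => //= a w /andP[an _].
exact: ltnW.
Qed.

(** An entry of the word coded by m is at most m, so the first n letters of r determine the first n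
    letters of [quine r]. Hence [quine r] is computable from r. *)
Lemma eq_quine_word r r' n : {in gtn n, r =1 r'} ->
  quine_word r n = quine_word r' n.
Proof.
elim: n => // n IH rr; rewrite /quine_word !iteriS -!/(quine_word _ _) IH.
  congr rcons; rewrite /quine_letter; case: ifP => // wN; apply: rr.
  rewrite inE ltnS; apply: leq_trans (leq_pred _) (head_decode n).
by move=> k; rewrite inE => kn; apply: rr; rewrite inE ltnW // ltnS.
Qed.

Lemma word_fun_quine r n : word_fun (quine r) (mkseq (fun=> 0) n) =
  mkseq (pair_baire (quine r) p0) n.
Proof.
rewrite /word_fun quineE /quine_letter CodeSeq.codeK size_mkseq.
rewrite mkseq_zero eqxx CodeSeq.codeK; apply/eq_in_map => i.
rewrite mem_iota /= => lt.
rewrite /pair_baire; case: ifP => // _; rewrite nth_mkseq //.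
apply: leq_trans (_ : n <= _); last by rewrite -{1}(size_nseq n 0) size_code.
exact: leq_ltn_trans (leq_half i) lt.
Qed.

Lemma Phi_quine r : Phi (quine r) (fun=> 0) (pair_baire (quine r) p0).
Proof.
split=> [n|m]; first by rewrite word_fun_quine size_mkseq.
by exists m; rewrite word_fun_quine size_mkseq.
Qed.

(** The successor keeps the one-letter word apart from the zero words, whose letters are used by the
    program. *)
Lemma quine_hidden r k : quine r (CodeSeq.code [:: k.+1]) = r k.
Proof. by rewrite quineE /quine_letter CodeSeq.codeK. Qed.

(** The program e of the overview. A word of length n is continued by zeros and answered by n
    letters, which do not depend on the continuation. *)
Definition make_quine : baire := fun n =>
  CodeSeq.code (mkseq (pair_baire (quine (nth 0 (CodeSeq.decode n))) p0)
                      (size (CodeSeq.decode n))).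

Lemma Phi_make_quine r : Phi make_quine r (pair_baire (quine r) p0).
Proof.
have H n : word_fun make_quine (mkseq r n) =
    mkseq (pair_baire (quine r) p0) n.
  rewrite /word_fun /make_quine !CodeSeq.codeK size_mkseq.
  apply/eq_in_map => i; rewrite mem_iota /= => lt; rewrite /pair_baire.
  case: ifP => // _; have lt2 : (i./2).+1 <= n.
    exact: leq_ltn_trans (leq_half i) lt.
  (* Continuing the known letters of r by 0 leaves the letters of the quine up to [i./2]
     unchanged. *)
  have := @eq_quine_word (nth 0 (mkseq r n)) r (i./2).+1.
  rewrite !quine_wordE => /(_ _)/(congr1 (fun w => nth 0 w i./2)).
  rewrite !nth_mkseq // => -> // k; rewrite inE => kl.
  by rewrite nth_mkseq // (leq_trans kl).
by split=> [n|m]; [rewrite H size_mkseq|exists m; rewrite H size_mkseq].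
Qed.

Hypothesis p0_rec : recursive1 p0.

Lemma cfun_rcons X {cX : coded X} (u : X -> seq nat) (f : X -> nat) :
  cfun u -> cfun f -> cfun (fun x => rcons (u x) (f x)).
Proof.
move=> cu cf; have -> : (fun x => rcons (u x) (f x)) = (fun x =>
    mkseq (fun i => if i < size (u x) then nth 0 (u x) i else f x)
          (size (u x)).+1).
  apply/funext => x; apply: (@eq_from_nth _ 0).
    by rewrite size_rcons size_mkseq.
  move=> i; rewrite size_rcons ltnS => lt.
  rewrite nth_mkseq // nth_rcons; case: ifP => // /negbT; rewrite -leqNgt => le.
  by rewrite eqn_leq lt le.
by cfun_auto.
Qed.

Lemma cfun_quine_letter :
  cfun (fun y : seq nat * (nat * seq nat) =>
    quine_letter (nth 0 y.1) y.2.1 y.2.2).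
Proof.
have cp : cfun p0 by apply/cfun_nat.
rewrite /quine_letter; cbv zeta.
have -> : (fun y : seq nat * (nat * seq nat) =>
  if CodeSeq.decode y.2.1 == nseq (size (CodeSeq.decode y.2.1)) 0 then
    CodeSeq.code (mkseq (fun i => if odd i then p0 i./2 else nth 0 y.2.2 i./2)
                        (size (CodeSeq.decode y.2.1)))
  else nth 0 y.1 (nth 0 (CodeSeq.decode y.2.1) 0).-1) = (fun y =>
  if CodeSeq.decode y.2.1 == mkseq (fun=> 0) (size (CodeSeq.decode y.2.1)) then
    CodeSeq.code (mkseq (fun i => if odd i then p0 i./2 else nth 0 y.2.2 i./2)
                        (size (CodeSeq.decode y.2.1)))
  else nth 0 y.1 (nth 0 (CodeSeq.decode y.2.1) 0).-1).
  by apply/funext => y; rewrite mkseq_zero.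
by cfun_auto.
Qed.

Lemma cfun_quine :
  cfun (fun y : seq nat * nat => quine (nth 0 y.1) y.2).
Proof.
rewrite /quine.
have cw : cfun (fun y : seq nat * nat => quine_word (nth 0 y.1) y.2).
  rewrite /quine_word; apply: cfun_iteri (cfun_snd cfun_id) _ (cfun_const _).
  apply: cfun_rcons (cfun_snd (cfun_snd cfun_id)) _.
  apply: (cfun_comp (f := fun y => (y.1.1, y.2)) cfun_quine_letter).
  by cfun_auto.
apply: (cfun_comp (f := fun y => (y.1, (y.2, quine_word (nth 0 y.1) y.2)))
  cfun_quine_letter).
by cfun_auto.
Qed.

Lemma sW_le_infloop (X Y : repspace) (f : problem X Y) :
  realizer_version f p0 = [set fun=> 0] -> sW_le f (infloop f).
Proof.
move=> fp0; set F := realizer_version f.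
have cp : cfun p0 by apply/cfun_nat.
have cq := cfun_quine.
pose gk (u : seq nat) n :=
  if odd n then nth 0 u n./2 else make_quine n./2.
(* Position of the letter [r k] in the output: row 1 is the pair of the quine and [p0], and the
   quine occupies its even positions. *)
pose g k := Cantor.to_nat (1, (CodeSeq.code [:: k.+1]).*2).
pose h (w : seq nat) k := if g k < size w then (nth 0 w (g k)).+1 else 0.
apply: (@sW_le_search _ _ _ _ _ _ (pair_baire make_quine) gk h).
- move=> p n; rewrite /gk /pair_baire; case: ifP => // on.
  by rewrite nth_mkseq //; case: n on => // n _; rewrite ltnS leq_uphalf_double
    -addnn leq_addr.
- rewrite /gk /make_quine /pair_baire.
  cfun_auto.
  apply: (cfun_comp (f := fun y : seq nat * nat * nat =>
    (CodeSeq.decode y.1.2./2, y.2./2)) cq).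
  by cfun_auto.
- by rewrite /h /g; cfun_auto.
move=> p [r0 Fr0].
have body0 s : loop_body F (pair_baire make_quine p) s <->
    exists2 r, F p r & s = pair_baire (quine r) p0.
  rewrite loop_bodyE even_pair odd_pair; split=> [[_ [r Fr Pr]]|[r Fr ->]].
    by exists r => //; apply: Phi_fun Pr (Phi_make_quine r).
  split; last by exists r => //; apply: Phi_make_quine.
  by move=> r' _; exists (pair_baire (quine r') p0); apply: Phi_make_quine.
have body1 r : loop_body F (pair_baire (quine r) p0) (pair_baire (quine r) p0).
  rewrite loop_bodyE even_pair odd_pair /F fp0; split=> [_ ->|].
    by exists (pair_baire (quine r) p0); apply: Phi_quine.
  by exists (fun=> 0) => //; apply: Phi_quine.
have stage i s : loop_stage F (pair_baire make_quine p) i.+1 s ->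
    exists r, s = pair_baire (quine r) p0.
  elim: i s => [|i IH] s /=.
    by move=> [_ -> /body0[r _ ->]]; exists r.
  move=> [q /IH[r ->]]; rewrite loop_bodyE even_pair odd_pair /F fp0.
  move=> [_ [_ -> Pr]]; exists r; exact: Phi_fun Pr (Phi_quine r).
have dloop : loop_dom F (pair_baire make_quine p).
  case=> [_ ->|i s /stage[r ->]].
    by exists (pair_baire (quine r0) p0); apply/body0; exists r0.
  by exists (pair_baire (quine r) p0).
have loopE t : realizer_version (infloop f) (pair_baire make_quine p) t <->
    loop_baire F (pair_baire make_quine p) t.
  rewrite realizer_versionE; split=> [[_ [_ [<- ft <-]]]//|ft].
  by exists (pair_baire make_quine p), t.
split.
  by have := dloop; rewrite -dom_loop_baire => -[t /loopE tP]; exists t.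
move=> t /loopE[_ [s [s0 sS ->]]].
have /body0[r Fr s1] : loop_body F (pair_baire make_quine p) (s 1).
  by rewrite -s0.
exists r => // k; have gE : tuple_baire s (g k) = r k.
  rewrite /tuple_baire /g Cantor.cancel_of_to [LHS]/= s1.
  by rewrite -/(even_part _ _) even_pair quine_hidden.
split=> [n|]; rewrite /h.
  rewrite size_mkseq; case: ifP => lt; last by left.
  by rewrite nth_mkseq // gE; right.
by exists (g k).+1; rewrite size_mkseq ltnSn.
Qed.

End Quine.

(** * Approximating the stages of the loop *)

Lemma near_ltn (P : nat -> nat -> Prop) m :
  (forall k, \forall n \near \oo, P k n) ->
  \forall n \near \oo, forall k, k < m -> P k n.
Proof.
move=> h; elim: m => [|m IH]; first exact: nearW.
near=> n => k; rewrite ltnS leq_eqVlt => /predU1P[->|]; first by near: n.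
by move: k; near: n.
Unshelve. all: by end_near. Qed.

(** Prefixes of one sequence, indexed by the time of computation: their lengths tend to infinity but
    need not increase, which suits the searches below. *)
Definition approximates (S : nat -> seq nat) (s : baire) : Prop :=
  (forall n, S n = mkseq s (size (S n))) /\
  forall m, \forall n \near \oo, m <= size (S n).

Lemma approximates_mkseq s : approximates (mkseq s) s.
Proof.
split=> [n|m]; first by rewrite size_mkseq.
by near=> n; rewrite size_mkseq; near: n; exact: nbhs_infty_ge.
Unshelve. all: by end_near. Qed.

Lemma approximates_collect (h : nat -> nat -> nat) b s :
  (forall n k, partial_value (h n k) (s k)) ->
  (forall m, \forall n \near \oo, m <= b n) ->
  (forall k, \forall n \near \oo, h n k != 0) ->
  approximates (fun n => collect (h n) (b n)) s.
Proof.
move=> hs bo hn; split=> [n|m]; first exact: collectE.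
near=> n; apply: collect_size; first by near: n.
by near: n; apply: near_ltn.
Unshelve. all: by end_near. Qed.

Lemma nth_approximates S s n k : approximates S s -> k < size (S n) ->
  nth 0 (S n) k = s k.
Proof. by move=> [Ss _] lt; rewrite Ss nth_mkseq. Qed.

(** Turns approximations of s into approximations of [s \o g]. The instances of [g] extract the
    program, the input, and the rows of a tuple. *)
Definition subword (g : nat -> nat) (u : seq nat) : seq nat :=
  collect (fun j => if g j < size u then (nth 0 u (g j)).+1 else 0) (size u).

Lemma approximates_subword g S s : approximates S s ->
  approximates (fun n => subword g (S n)) (s \o g).
Proof.
move=> Ss; apply: approximates_collect => [n k||k].
- by case: ifP => lt; [right; rewrite (nth_approximates Ss)|left].
- by have [_] := Ss.
- by have [_ /(_ (g k).+1)] := Ss; apply: filterS => n ->.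
Qed.

Lemma cfun_subword X {cX : coded X} (g : X -> nat -> nat) (u : X -> seq nat) :
  cfun (fun y : X * nat => g y.1 y.2) -> cfun u ->
  cfun (fun x => subword (g x) (u x)).
Proof. by move=> cg cu; rewrite /subword; cfun_auto. Qed.

(* Collects the letters of all the words that [u], a prefix of a pair
   [pair_baire q p], determines [word_fun q] to take on the prefixes of [v]. *)
Definition apply_word (u v : seq nat) : seq nat :=
  let q := subword double u in
  let c n := CodeSeq.code (take n v) in
  let w n := CodeSeq.decode (nth 0 q (c n)) in
  collect (fun j => first (fun n =>
    if (c n < size q) && (j < size (w n)) then (nth 0 (w n) j).+1 else 0)
      (size v).+1) (size v).

(** Every answer of the program on a prefix of r is a prefix of s', so whichever answer is found
    first gives the right letter; one long enough is found once U reaches the code of a suitable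
    prefix. *)
Lemma approximates_apply U V s r s' : approximates U s -> approximates V r ->
  Phi (even_part s) r s' ->
  approximates (fun n => apply_word (U n) (V n)) s'.
Proof.
move=> /(approximates_subword double) Qs Vr [Ps Pu].
rewrite -/(even_part s) in Qs.
have VE N n : n <= size (V N) -> take n (V N) = mkseq r n.
  have [-> _] := Vr; rewrite size_mkseq => nV.
  by rewrite take_mkseq (minn_idPl nV).
apply: approximates_collect => [N j||j]; last 1 first.
- have [n jn] := Pu j.+1; near=> N; apply/firstN0.
  have nV : n <= size (V N) by near: N; have [_] := Vr; apply.
  exists n; rewrite ?ltnS //.
  have lt : CodeSeq.code (take n (V N)) < size (subword double (U N)).
    rewrite VE //; near: N; have [_] := Qs; apply.
  by rewrite lt (nth_approximates Qs lt) VE // -/(word_fun _ _) jn.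
- apply: first_value => n; case: ifP => [/andP[lt]|]; last by left.
  rewrite (nth_approximates Qs lt) -/(word_fun _ _).
  have [-> _] := Vr; rewrite take_mkseq Ps size_mkseq => jlt.
  by rewrite nth_mkseq //; right.
- by have [_] := Vr.
Unshelve. all: by end_near. Qed.

Lemma cfun_apply_word X {cX : coded X} (u v : X -> seq nat) :
  cfun u -> cfun v -> cfun (fun x => apply_word (u x) (v x)).
Proof.
move=> cu cv; rewrite /apply_word; cbv zeta beta.
have cq : cfun (fun x => subword double (u x)).
  apply: (cfun_subword (g := fun=> double)) => //.
  exact: cfun_double (cfun_snd cfun_id).
have cE X' (cX' : coded X') (f : X' -> X) (g : X' -> nat) : cfun f -> cfun g ->
    cfun (fun x => nth 0 (subword double (u (f x))) (g x)).
  by move=> cf cg; apply: cfun_nth cg; apply: cfun_comp cq cf.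
by cfun_auto; apply: (cfun_comp cq); cfun_auto.
Qed.

(* Cantor choice yields binary sequences only; hence the input of the loop is
   handed over by the characteristic function of its graph. *)
Definition graph (q : baire) : baire :=
  fun k => q (Cantor.of_nat k).1 == (Cantor.of_nat k).2.

Definition graph_word (w : seq nat) : seq nat :=
  collect (fun a => first (fun b =>
    if nth 0 w (Cantor.to_nat (a, b)) == 1 then b.+1 else 0) (size w)) (size w).

Lemma approximates_graph W q : approximates W (graph q) ->
  approximates (fun n => graph_word (W n)) q.
Proof.
move=> Wq; apply: approximates_collect => [n a||a].
- apply: first_value => b; case: ifP => [/eqP e|]; last by left.
  have lt : Cantor.to_nat (a, b) < size (W n).
    by rewrite ltnNge; apply/negP => le; rewrite nth_default in e.
  move: e; rewrite (nth_approximates Wq lt) /graph Cantor.cancel_of_to /=.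
  by case: eqP => // -> _; right.
- by have [_] := Wq.
- have [_ /(_ (Cantor.to_nat (a, q a)).+1)] := Wq; apply: filterS => n lt.
  apply/firstN0; exists (q a).
    (* The search bound suffices because b is at most [Cantor.to_nat (a, b)]. *)
    apply: leq_trans lt; rewrite ltnS; apply/leP.
    apply: PeanoNat.Nat.le_trans (Cantor.to_nat_non_decreasing a (q a)).
    exact/leP/leq_addr.
  by rewrite (nth_approximates Wq lt) /graph Cantor.cancel_of_to /= eqxx.
Qed.

Lemma cfun_graph_word X {cX : coded X} (u : X -> seq nat) :
  cfun u -> cfun (fun x => graph_word (u x)).
Proof. by move=> cu; rewrite /graph_word; cfun_auto. Qed.

Definition row (i : nat) (t : baire) : baire :=
  fun j => t (Cantor.to_nat (i, j)).

Lemma row_tuple s i : row i (tuple_baire s) = s i.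
Proof. by apply/funext => j; rewrite /row /tuple_baire Cantor.cancel_of_to. Qed.

Lemma row_inj t t' : (forall i, row i t = row i t') -> t = t'.
Proof.
move=> h; apply/funext => n; rewrite -(Cantor.cancel_to_of n).
by case: (Cantor.of_nat n) => i j; apply: (congr1 (fun r => r j) (h i)).
Qed.

Definition row_word (i : nat) (w : seq nat) : seq nat :=
  subword (fun j => Cantor.to_nat (i, j)) w.

(** Replays the run from a candidate alone: row 0 encodes the input, row j.+1 is the answer in stage
    j. The result is always a word, but it means something only if the candidate is a run. *)
Definition stage_word (w : seq nat) (i : nat) : seq nat :=
  iteri i (fun j u => apply_word u (row_word j.+1 w))
          (graph_word (row_word 0 w)).

Lemma approximates_row i t :
  approximates (fun n => row_word i (mkseq t n)) (row i t).
Proof. exact: approximates_subword (approximates_mkseq t). Qed.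

Lemma cfun_row_word X {cX : coded X} (i : X -> nat) (w : X -> seq nat) :
  cfun i -> cfun w -> cfun (fun x => row_word (i x) (w x)).
Proof.
move=> ci cw.
apply: (cfun_subword (g := fun x j => Cantor.to_nat (i x, j))) => //.
by cfun_auto.
Qed.

Lemma cfun_stage_word X {cX : coded X} (w : X -> seq nat) (i : X -> nat) :
  cfun w -> cfun i -> cfun (fun x => stage_word (w x) (i x)).
Proof.
move=> cw ci; rewrite /stage_word; apply: (cfun_iteri ci).
  apply: cfun_apply_word (cfun_snd (cfun_snd cfun_id)) _.
  by apply: cfun_row_word; cfun_auto.
exact: cfun_graph_word (cfun_row_word (cfun_const 0) cw).
Qed.

(** * A loop reduces to its problem *)

Section Runs.
(** [letter] singles out the sequences over the alphabet and [reject] refutes wrong answers. The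
    letters 0 and 1 must be available because a solution contains the graph of the input. *)
Variables (F : baire -> set baire) (letter : pred nat)
  (reject : seq nat -> seq nat -> bool).
Hypotheses (letter0 : letter 0) (letter1 : letter 1).
Hypothesis reject_mono : forall u u' v v', prefix u u' -> prefix v v' ->
  reject u v -> reject u' v'.
Hypothesis rejectP : forall p r, dom F p -> F p r <->
  (forall k, letter (r k)) /\ forall n, ~~ reject (mkseq p n) (mkseq r n).
Hypothesis cfun_reject : cfun (fun y : seq nat * seq nat => reject y.1 y.2).

(** Row 0 is compared with the graph of the input only where u decides it. The bound on i grows with
    w, so that every stage is tested eventually. *)
Definition bad (u w : seq nat) : bool :=
  has (fun k => ((Cantor.of_nat k).1 < size u) &&
                (nth 0 (row_word 0 w) k != graph (nth 0 u) k))
      (iota 0 (size (row_word 0 w))) ||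
  has (fun i => reject (subword (fun j => j.*2.+1) (stage_word w i))
                       (row_word i.+1 w)) (iota 0 (size w)).

Definition solution (q0 t : baire) : Prop :=
  (forall k, letter (t k)) /\ forall n, ~~ bad (mkseq q0 n) (mkseq t n).

(** Runs are the intended sequences, solutions the unrefuted ones. For inputs in the domain of the
    loop and sequences over the alphabet, both notions coincide. *)
Definition run (q0 t : baire) (s : nat -> baire) : Prop :=
  [/\ row 0 t = graph q0, s 0 = q0 &
    forall i, F (odd_part (s i)) (row i.+1 t) /\
              Phi (even_part (s i)) (row i.+1 t) (s i.+1)].

Lemma approximates_prefix U p n : approximates U p ->
  \forall N \near \oo, prefix (mkseq p n) (U N).
Proof.
move=> [Up /(_ n)]; apply: filterS => N nN; rewrite Up prefixE.
by rewrite size_mkseq take_mkseq (minn_idPl nN).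
Qed.

Lemma prefix_mkseq (p : baire) m n : m <= n -> prefix (mkseq p m) (mkseq p n).
Proof. by move=> mn; rewrite prefixE size_mkseq take_mkseq (minn_idPl mn). Qed.

Lemma run_approximates q0 t s : run q0 t s ->
  forall i, approximates (fun n => stage_word (mkseq t n) i) (s i).
Proof.
move=> [t0 s0 sP]; elim=> [|i IH].
  rewrite s0; apply: approximates_graph; rewrite -t0.
  exact: approximates_row.
by have [_] := sP i; apply: approximates_apply IH (approximates_row i.+1 t).
Qed.

(** Here and in [reject_near], monotonicity exchanges prefixes of equal length for approximations
    whose lengths grow independently. *)
Lemma reject_all U V p r : approximates U p -> approximates V r ->
  (forall n, ~~ reject (mkseq p n) (mkseq r n)) ->
  forall N, ~~ reject (U N) (V N).
Proof.
move=> [Up _] [Vr _] h N; rewrite Up Vr.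
apply: contraNN (h (maxn (size (U N)) (size (V N)))).
by apply: reject_mono; apply: prefix_mkseq; rewrite ?leq_maxl ?leq_maxr.
Qed.

Lemma reject_near U V p r : approximates U p -> approximates V r ->
  (\forall N \near \oo, ~~ reject (U N) (V N)) ->
  forall n, ~~ reject (mkseq p n) (mkseq r n).
Proof.
move=> Up Vr h n.
near \oo => N; have : ~~ reject (U N) (V N) by near: N.
by apply: contraNN; apply: reject_mono; near: N; apply: approximates_prefix.
Unshelve. all: by end_near. Qed.

Lemma solution_graph q0 t : solution q0 t -> row 0 t = graph q0.
Proof.
move=> [_ tP]; apply/funext => k; apply/eqP.
have Rk := approximates_row 0 t.
near \oo => n; have /norP[/hasPn/(_ k) h _] := tP n.
have kn : k < size (row_word 0 (mkseq t n)).
  by near: n; have [_] := Rk; apply.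
have ln : (Cantor.of_nat k).1 < n by near: n; exact: nbhs_infty_gt.
move: h; rewrite mem_iota kn size_mkseq ln (nth_approximates Rk kn) negbK.
by rewrite /graph nth_mkseq // => ->.
Unshelve. all: by end_near. Qed.

Lemma solution_reject q0 t s i : solution q0 t ->
  approximates (fun n => stage_word (mkseq t n) i) s -> dom F (odd_part s) ->
  F (odd_part s) (row i.+1 t).
Proof.
move=> [tl tP] Ss dF; apply/(rejectP _ dF); split=> [k|]; first exact: tl.
apply: reject_near (approximates_subword (fun j => j.*2.+1) Ss)
  (approximates_row i.+1 t) _.
near=> n; have /norP[_ /hasPn/(_ i)] := tP n; apply.
by rewrite mem_iota size_mkseq; near: n; exact: nbhs_infty_gt.
Unshelve. all: by end_near. Qed.

Lemma run_solution q0 t s : (forall k, letter (t k)) -> run q0 t s ->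
  solution q0 t.
Proof.
move=> tl rt; have [t0 s0 sP] := rt; split=> // n.
rewrite negb_or; apply/andP; split; apply/hasPn => k; rewrite mem_iota => lt.
  rewrite negb_and -implybE; apply/implyP; rewrite size_mkseq => kn.
  rewrite (nth_approximates (approximates_row 0 t) lt) t0 negbK.
  by rewrite /graph nth_mkseq.
have [Fr _] := sP k.
have dF : dom F (odd_part (s k)) by exists (row k.+1 t).
have [_ h] := (rejectP _ dF).1 Fr.
have ap := approximates_subword (fun j => j.*2.+1) (run_approximates rt k).
exact: (reject_all ap (approximates_row k.+1 t) h).
Qed.

Lemma run_stage q0 t s i : run q0 t s -> loop_dom F q0 ->
  loop_stage F q0 i (s i).
Proof.
move=> [_ s0 sP] dq; elim: i => [//|i IH]; exists (s i) => //.
apply/loop_bodyE; split; last by have [] := sP i; exists (row i.+1 t).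
by have [s' /loop_bodyE[]] := dq i _ IH.
Qed.

(** A stage reached in the loop has some answer, so an unrejected answer is correct there; the
    domain of the loop makes the program converge on it, and the value is the next stage. *)
Lemma solution_run q0 t : loop_dom F q0 -> solution q0 t ->
  exists s, run q0 t s.
Proof.
move=> dq tS.
have Psi qr : exists s, dom (Phi qr.1) qr.2 -> Phi qr.1 qr.2 s.
  have [[s Ps]|nd] := pselect (dom (Phi qr.1) qr.2); first by exists s.
  by exists qr.1.
have [G GP] := choice Psi.
pose s i := iteri i (fun j u => G (even_part u, row j.+1 t)) q0.
(* Both facts travel together: reachability yields the domain conditions, and approximation lets
   [bad] see the true stage. *)
suff H i : loop_stage F q0 i (s i) /\
    approximates (fun n => stage_word (mkseq t n) i) (s i) ->
    F (odd_part (s i)) (row i.+1 t) /\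
    Phi (even_part (s i)) (row i.+1 t) (s i.+1).
  exists s; split=> //; first exact: solution_graph tS.
  move=> i; apply: (H i); elim: i => [|i IH].
    split=> //; apply: approximates_graph; rewrite -(solution_graph tS).
    exact: approximates_row.
  have [Fr Pr] := H i IH; have [st ap] := IH; split.
    exists (s i) => //; apply/loop_bodyE; split; last by exists (row i.+1 t).
    by have [s' /loop_bodyE[]] := dq i _ st.
  exact: approximates_apply ap (approximates_row i.+1 t) Pr.
move=> [st ap]; have [s' /loop_bodyE[dr [r Fr _]]] := dq i _ st.
have Fi : F (odd_part (s i)) (row i.+1 t).
  by apply: solution_reject tS ap _; exists r.
by split=> //; apply: (GP (_, _)); apply: dr.
Qed.

Lemma solution_exists q0 : loop_dom F q0 -> exists t, solution q0 t.
Proof.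
move=> dq; have := dq; rewrite -dom_loop_baire => -[_ [_ [s [s0 sS _]]]].
have rP i : exists r, F (odd_part (s i)) r /\
    Phi (even_part (s i)) r (s i.+1).
  by have /loop_bodyE[_ [r Fr Pr]] := sS i; exists r.
have [r rE] := choice rP.
pose t := tuple_baire (fun i => if i is j.+1 then r j else graph q0).
have rt : run q0 t s by split=> // [|i]; rewrite row_tuple.
exists t; apply: run_solution rt => k; rewrite /t /tuple_baire.
(* Row 0 is a characteristic function, hence the appeal to the letters 0 and 1; the other rows are
   answers of [F]. *)
case: (Cantor.of_nat k) => -[|i] j /=; first by rewrite /graph; case: eqP.
have [Fr _] := rE i; have dF : dom F (odd_part (s i)) by exists (r i).
by have [/(_ j)] := (rejectP _ dF).1 Fr.
Qed.

Definition read_run (w : seq nat) (k : nat) : nat :=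
  if (Cantor.of_nat k).2 < size (stage_word w (Cantor.of_nat k).1) then
    (nth 0 (stage_word w (Cantor.of_nat k).1) (Cantor.of_nat k).2).+1
  else 0.

Lemma solution_loop q0 t : loop_dom F q0 -> solution q0 t ->
  exists2 r, search_fun read_run t r & loop_baire F q0 r.
Proof.
move=> dq tS; have [s rt] := solution_run dq tS.
exists (tuple_baire s); last first.
  have [_ s0 sP] := rt; split=> //; exists s; split=> // i; apply/loop_bodyE.
  split; last by have [] := sP i; exists (row i.+1 t).
  by have [s' /loop_bodyE[]] := dq i _ (run_stage i rt dq).
move=> k; rewrite /read_run /tuple_baire; case: (Cantor.of_nat k) => i j /=.
have ap := run_approximates rt i; split=> [n|].
  by case: ifP => lt; [right; rewrite (nth_approximates ap lt)|left].
near \oo => n; exists n; suff -> : j < size (stage_word (mkseq t n) i) by [].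
by near: n; have [_] := ap; apply.
Unshelve. all: by end_near. Qed.

(** Equal stages have equal answers since [F] has at most one, and equal answers lead to equal next
    stages; the rows determine the sequence. *)
Lemma solution_unique q0 t t' : (forall p, is_subset1 (F p)) ->
  loop_dom F q0 -> solution q0 t -> solution q0 t' -> t = t'.
Proof.
move=> F1 dq tS tS'.
have [s [t0 s0 sP]] := solution_run dq tS.
have [s' [t0' s0' sP']] := solution_run dq tS'.
have rr i : s i = s' i -> row i.+1 t = row i.+1 t'.
  move=> e; have [Fr _] := sP i; have [Fr' _] := sP' i.
  by apply: F1 Fr _; rewrite e.
have ss i : s i = s' i.
  elim: i => [|i IH]; first by rewrite s0.
  have [_ Pr] := sP i; have [_ Pr'] := sP' i.
  by apply: Phi_fun Pr _; rewrite IH (rr _ IH).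
by apply: row_inj => -[|i]; [rewrite t0|apply: rr].
Qed.

Lemma cfun_bad X {cX : coded X} (u w : X -> seq nat) :
  cfun u -> cfun w -> cfun (fun x => bad (u x) (w x)).
Proof.
move=> cu cw; rewrite /bad /graph.
have c0 : cfun (fun x => row_word 0 (w x)) by apply: cfun_row_word; cfun_auto.
cfun_auto; first exact: c0.
- by apply: (cfun_comp c0); cfun_auto.
- apply: (cfun_subword (g := fun=> (fun j => j.*2.+1))); first by cfun_auto.
  by apply: cfun_stage_word; cfun_auto.
- by apply: cfun_row_word; cfun_auto.
Qed.

Lemma cfun_read_run : cfun (fun y : seq nat * nat => read_run y.1 y.2).
Proof.
have cs : cfun (fun y : seq nat * nat =>
    stage_word y.1 (Cantor.of_nat y.2).1).
  by apply: cfun_stage_word; cfun_auto.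
by rewrite /read_run; cfun_auto; exact: cs.
Qed.
End Runs.

Lemma realizer_infloop (X Y : repspace) (f : problem X Y) p t :
  realizer_version (infloop f) p t <-> loop_baire (realizer_version f) p t.
Proof.
rewrite realizer_versionE; split=> [[_ [_ [<- ft <-]]]//|ft].
by exists p, t.
Qed.

(** What remains for each problem is a name whose answers are the solutions. This is asked on the
    domain of the loop, where solutions exist and, for unique choice, are unique. *)
Lemma sW_infloop_le (X Y : repspace) (f : problem X Y) (letter : pred nat)
    (reject : seq nat -> seq nat -> bool) (k : baire -> baire)
    (gk : seq nat -> nat -> nat) :
  letter 0 -> letter 1 ->
  (forall u u' v v', prefix u u' -> prefix v v' ->
    reject u v -> reject u' v') ->
  (forall p r, dom (realizer_version f) p -> realizer_version f p r <->
    (forall i, letter (r i)) /\ forall n, ~~ reject (mkseq p n) (mkseq r n)) ->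
  cfun (fun y : seq nat * seq nat => reject y.1 y.2) ->
  (forall p n, k p n = gk (mkseq p n) n) ->
  cfun (fun y : seq nat * nat => gk y.1 y.2) ->
  (forall p, loop_dom (realizer_version f) p -> forall r,
    realizer_version f (k p) r <-> solution letter reject p r) ->
  sW_le (infloop f) f.
Proof.
move=> l0 l1 rmono rP crej kE cgk kP.
apply: (sW_le_search kE cgk (cfun_read_run)) => p [t /realizer_infloop[dp _]].
split=> [|r /(kP p dp) rS].
  have [r rS] := solution_exists l0 l1 rmono rP dp.
  by exists r; apply/(kP p dp).
have [s hs ls] := solution_loop rmono rP dp rS; exists s => //.
exact/realizer_infloop.
Qed.

(** * Closed choice *)

Section ClosedChoice.
Variables (A : discreteTopologicalType) (c : A -> nat) (c_inj : injective c)
  (letter : pred nat).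
Hypothesis letterP : forall a, letter a <-> exists x, c x = a.
Hypotheses (letter0 : letter 0) (letter1 : letter 1).

Lemma cylinderP w (x : {ptws nat -> A}) :
  cylinder c w x <-> prefix w (mkseq (c \o x) (size w)).
Proof.
by rewrite prefixE take_mkseq minnn; split=> /eqP.
Qed.

Lemma open_cylinder_set w : open (cylinder c w).
Proof.
elim/last_ind: w => [|w a IH].
  rewrite (_ : cylinder c [::] = setT); first exact: openT.
  by apply/seteqP; split.
have -> : cylinder c (rcons w a) = cylinder c w `&`
    (fun x : {ptws nat -> A} => x (size w)) @^-1` [set b | c b = a].
  apply/seteqP; rewrite /cylinder size_rcons; split=> x /=; rewrite mkseqS.
    by move/rcons_inj => -[].
  by move=> [ew ea]; rewrite ew /= ea.
apply: openI => //; apply: open_comp; last exact: discrete_open.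
by move=> x _; apply: proj_continuous.
Qed.

(** An answer is refuted once it extends the word of an excluded cylinder. The entry 0 excludes
    nothing, hence the positivity test and the predecessor. *)
Definition reject_closed (u v : seq nat) : bool :=
  has (fun j => (0 < nth 0 u j) && prefix (CodeSeq.decode (nth 0 u j).-1) v)
      (iota 0 (size u)).

Lemma reject_closed_mono u u' v v' : prefix u u' -> prefix v v' ->
  reject_closed u v -> reject_closed u' v'.
Proof.
move=> /prefixP[u2 ->] pv /hasP[j]; rewrite mem_iota /= add0n.
move=> ju /andP[j0 pj]; apply/hasP; exists j.
  by rewrite mem_iota size_cat /= add0n (leq_trans ju) ?leq_addr.
by rewrite nth_cat ju j0 (prefix_trans pj pv).
Qed.

Lemma cfun_reject_closed :
  cfun (fun y : seq nat * seq nat => reject_closed y.1 y.2).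
Proof. by rewrite /reject_closed; cfun_auto. Qed.

Lemma reject_closedP p (x : {ptws nat -> A}) :
  (forall n, ~~ reject_closed (mkseq p n) (mkseq (c \o x) n)) <->
  ~ (\bigcup_i enum_cylinder c (p i)) x.
Proof.
split=> [h [i _]|h n].
  case pi: (p i) => [//|m] /cylinderP px; set w := CodeSeq.decode m in px.
  (* Long enough for the input to show entry i and for the answer to cover w. *)
  have /hasPn/(_ i) := h (maxn i.+1 (size w)).
  rewrite mem_iota size_mkseq leq_maxl => /(_ isT)/negP; apply.
  rewrite nth_mkseq ?leq_maxl // pi; apply: prefix_trans px _.
  by apply: prefix_mkseq; rewrite leq_maxr.
apply/hasPn => j; rewrite mem_iota size_mkseq => /= jn.
rewrite nth_mkseq //; apply/negP => /andP[pj0 pw]; apply: h; exists j => //.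
case: (p j) pj0 pw => //= m _ pw; apply/cylinderP.
have sw := size_prefix pw; rewrite size_mkseq in sw.
by move: pw; rewrite !prefixE !take_mkseq minnn (minn_idPl sw).
Qed.

(** Cylinders are open, so every sequence is a name; names constructed below need no separate
    justification. *)
Lemma name_closed p : exists B : closed_set A, neg_name c p B.
Proof.
have cB : closed (~` \bigcup_i enum_cylinder c (p i)).
  apply: open_closedC; apply: bigcup_open => i _; case: (p i) => [|m].
    exact: open0.
  exact: open_cylinder_set.
by exists (exist _ _ cB); rewrite /neg_name /= setCK.
Qed.

Lemma lettersP (r : baire) :
  (forall i, letter (r i)) <-> exists x : {ptws nat -> A}, r = c \o x.
Proof.
split=> [rl|[x ->] i]; last by apply/letterP; exists (x i).
have [x xr] := choice (fun i => (letterP (r i)).1 (rl i)).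
by exists x; apply/funext => i /=.
Qed.

Lemma closed_choice_reject p r : realizer_version (closed_choice c_inj) p r <->
  (forall i, letter (r i)) /\
  forall n, ~~ reject_closed (mkseq p n) (mkseq r n).
Proof.
rewrite realizer_versionE lettersP; split.
  move=> [B [x [pB Bx ->]]]; split; first by exists x.
  by apply/reject_closedP; rewrite -pB.
move=> [[x ->] /reject_closedP px]; have [B pB] := name_closed p.
by exists B, x; split=> //; move: px; rewrite -pB; apply: contrapT.
Qed.

(** As [c] is injective, points correspond bijectively to their names, and being a singleton can be
    read off the names. *)
Lemma unique_choiceE p r : realizer_version (unique_choice c_inj) p r <->
  realizer_version (closed_choice c_inj) p = [set r].
Proof.
split.
  move=> /realizer_versionE[B [x [pB [[y By] Bx] ->]]].
  have xy : x = y by move: Bx; rewrite /closed_choice By.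
  apply/seteqP; split=> [r'|_ ->]; last by apply/realizer_versionE; exists B, x.
  move=> /realizer_versionE[B' [x' [pB' Bx' ->]]].
  by move: Bx'; rewrite /closed_choice (name_fun pB' pB) By => ->; rewrite xy.
move=> rE; have : [set r] r by []; rewrite -rE.
move=> /realizer_versionE[B [x [pB Bx rx]]].
apply/realizer_versionE; exists B, x; split=> //; split=> //; exists x.
apply/seteqP; split=> [x' Bx'|_ -> //].
have : [set r] (c \o x') by rewrite -rE; apply/realizer_versionE; exists B, x'.
rewrite rx => /= e; apply/funext => n; apply: c_inj.
exact: (congr1 (fun s => s n) e).
Qed.

(** Entry n excludes the cylinder of the word coded by n or nothing. That word has length at most n,
    so n letters of the input suffice to test it against the input prefix of its own length. *)
Definition bad_cylinders (u : seq nat) (n : nat) : nat :=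
  if bad reject_closed (take (size (CodeSeq.decode n)) u) (CodeSeq.decode n)
  then n.+1 else 0.

Lemma cfun_bad_cylinders :
  cfun (fun y : seq nat * nat => bad_cylinders y.1 y.2).
Proof.
rewrite /bad_cylinders; cfun_auto; apply: (cfun_bad cfun_reject_closed).
  by cfun_auto.
by cfun_auto.
Qed.

Definition solutions_name (q0 : baire) : baire :=
  fun n => bad_cylinders (mkseq q0 n) n.

Lemma closed_choice_solutions q0 r :
  realizer_version (closed_choice c_inj) (solutions_name q0) r <->
  solution letter reject_closed q0 r.
Proof.
have snE n : solutions_name q0 n =
    if bad reject_closed (mkseq q0 (size (CodeSeq.decode n))) (CodeSeq.decode n)
    then n.+1 else 0.
  rewrite /solutions_name /bad_cylinders take_mkseq (minn_idPl _) //.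
  by rewrite -{2}(CodeSeq.decodeK n) size_code.
rewrite closed_choice_reject /solution !lettersP.
split=> -[[x ->] h]; split; try by exists x.
  move=> n; apply/negP => badn; move/reject_closedP: h; apply.
  exists (CodeSeq.code (mkseq (c \o x) n)) => //.
  rewrite snE CodeSeq.codeK size_mkseq badn /= CodeSeq.codeK /cylinder /=.
  by rewrite size_mkseq.
apply/reject_closedP => -[i _]; rewrite snE; case: ifP => // badi.
rewrite /= /cylinder /= => wx; have /negP := h (size (CodeSeq.decode i)).
by rewrite wx.
Qed.

Lemma sW_infloop_closed :
  sW_le (infloop (closed_choice c_inj)) (closed_choice c_inj).
Proof.
apply: (sW_infloop_le (k := solutions_name) letter0 letter1
  reject_closed_mono _ cfun_reject_closed _ cfun_bad_cylinders) => //.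
  by move=> p r _; apply: closed_choice_reject.
by move=> p _ r; apply: closed_choice_solutions.
Qed.

Lemma unique_choice_sub p :
  is_subset1 (realizer_version (unique_choice c_inj) p).
Proof.
move=> r r' /unique_choiceE e /unique_choiceE e'.
by have : [set r] r by []; rewrite -e e'.
Qed.

(** The closed set used for closed choice serves again; on the domain of the loop it is a singleton
    by [solution_unique]. *)
Lemma sW_infloop_unique :
  sW_le (infloop (unique_choice c_inj)) (unique_choice c_inj).
Proof.
have rP p r : dom (realizer_version (unique_choice c_inj)) p ->
  realizer_version (unique_choice c_inj) p r <->
  (forall i, letter (r i)) /\
  forall n, ~~ reject_closed (mkseq p n) (mkseq r n).
  move=> [r0 /unique_choiceE p0].
  rewrite -closed_choice_reject unique_choiceE p0.
  by split=> [->|->].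
apply: (sW_infloop_le (k := solutions_name) letter0 letter1
  reject_closed_mono rP cfun_reject_closed _ cfun_bad_cylinders) => // p dp r.
rewrite unique_choiceE; split=> [e|rS].
  by apply/closed_choice_solutions; rewrite e.
apply/seteqP; split=> r' /= => [/closed_choice_solutions rS'|->].
  apply: (solution_unique reject_closed_mono rP _ dp rS' rS).
  exact: unique_choice_sub.
exact/closed_choice_solutions.
Qed.

(** Serves as [p0]: the cylinders of the nonzero words cover everything but the zero sequence. The
    predecessor matches the shift in [enum_cylinder]. *)
Definition zero_name : baire := fun n =>
  if (0 < n) && (CodeSeq.decode n.-1 !=
                 mkseq (fun=> 0) (size (CodeSeq.decode n.-1))) then n else 0.

Lemma zero_name_rec : recursive1 zero_name.
Proof. by apply/cfun_nat; rewrite /zero_name; cfun_auto. Qed.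

Lemma closed_choice_zero_name :
  realizer_version (closed_choice c_inj) zero_name = [set fun=> 0].
Proof.
apply/seteqP; split=> r /=.
  move=> /closed_choice_reject[/lettersP[x ->] /reject_closedP h].
  apply/funext => k; have [w ew] : exists w, w = mkseq (c \o x) k.+1 by eexists.
  have [wE|wN] := eqVneq w (mkseq (fun=> 0) (size w)).
    have := congr1 (fun u => nth 0 u k) wE.
    by rewrite ew size_mkseq !nth_mkseq.
  case: h; exists (CodeSeq.code w).+1 => //.
  have -> : zero_name (CodeSeq.code w).+1 = (CodeSeq.code w).+1.
    by rewrite /zero_name /= CodeSeq.codeK wN.
  by rewrite /enum_cylinder CodeSeq.codeK /cylinder /mkset ew size_mkseq.
move=> ->; apply/closed_choice_reject; split=> [//|].
have /lettersP[x x0] : forall i : nat, letter ((fun=> 0) i) by [].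
rewrite x0; apply/reject_closedP => -[[|m] _] //.
rewrite /zero_name /=; case: ifP => // wN wx; case/negP: wN.
by rewrite x0; apply/eqP; apply: esym.
Qed.

Lemma closed_choice_infloop :
  sW_equiv (infloop (closed_choice c_inj)) (closed_choice c_inj).
Proof.
split; first exact: sW_infloop_closed.
apply: (sW_le_infloop zero_name_rec). exact: closed_choice_zero_name.
Qed.

Lemma unique_choice_infloop :
  sW_equiv (infloop (unique_choice c_inj)) (unique_choice c_inj).
Proof.
split; first exact: sW_infloop_unique.
apply: (sW_le_infloop zero_name_rec); apply/seteqP; split=> r.
  move=> /unique_choiceE; rewrite closed_choice_zero_name => e.
  by have : [set r] r by []; rewrite -e.
by move=> ->; apply/unique_choiceE; apply: closed_choice_zero_name.
Qed.

End ClosedChoice.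

(** * Weak Koenig's lemma *)

Definition bit : pred nat := fun a => a < 2.

Lemma bitP a : bit a <-> exists b : bool, nat_of_bool b = a.
Proof.
split=> [|[b <-]]; last by case: b.
by case: a => [|[|]] // _; [exists false|exists true].
Qed.

Lemma bitsP (r : baire) :
  (forall i, bit (r i)) <-> exists x : nat -> bool, r = nat_of_bool \o x.
Proof. exact: (lettersP (A := bool) bitP). Qed.

(** The range of j includes the length of v, so v itself is tested too; words whose codes lie beyond
    u stay undecided. *)
Definition reject_tree (u v : seq nat) : bool :=
  has (fun j => (CodeSeq.code (take j v) < size u) &&
                (nth 0 u (CodeSeq.code (take j v)) == 0)) (iota 0 (size v).+1).

Lemma reject_tree_mono u u' v v' : prefix u u' -> prefix v v' ->
  reject_tree u v -> reject_tree u' v'.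
Proof.
move=> /prefixP[u2 ->] /prefixP[v2 ->] /hasP[j]; rewrite mem_iota /= add0n ltnS.
move=> jv /andP[lt e]; apply/hasP; exists j.
  by rewrite mem_iota /= add0n ltnS size_cat (leq_trans jv) ?leq_addr.
by rewrite takel_cat // size_cat nth_cat lt e andbT (leq_trans lt) ?leq_addr.
Qed.

Lemma cfun_reject_tree :
  cfun (fun y : seq nat * seq nat => reject_tree y.1 y.2).
Proof. by rewrite /reject_tree; cfun_auto. Qed.

Lemma WKL_E p r : realizer_version WKL p r <->
  (exists T, tree_name p T /\ infinite_set [set w | sval T w]) /\
  (forall i, bit (r i)) /\ forall n, p (CodeSeq.code (mkseq r n)) != 0.
Proof.
rewrite realizer_versionE bitsP; split.
  move=> [T [x [pT [Ti Tx] ->]]]; split; first by exists T.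
  split; first by exists x.
  by move=> n; rewrite pT Tx.
move=> [[T [pT Ti]] [[x ->] px]]; exists T, x; split=> //; split=> // n.
by have := px n; rewrite pT; case: (sval T _).
Qed.

Lemma reject_treeP p r :
  (forall n, ~~ reject_tree (mkseq p n) (mkseq r n)) <->
  forall n, p (CodeSeq.code (mkseq r n)) != 0.
Proof.
split=> h n.
  set m := CodeSeq.code _; have /hasPn/(_ n) := h (maxn m.+1 n).
  rewrite mem_iota /= add0n ltnS !size_mkseq leq_maxr take_mkseq => /(_ isT).
  rewrite (minn_idPl _) ?leq_maxr // -/m leq_maxl /= nth_mkseq //.
  by rewrite leq_maxl.
apply/hasPn => j; rewrite mem_iota /= add0n ltnS !size_mkseq => jn.
rewrite take_mkseq (minn_idPl jn) negb_and.
by case: leqP => //= lt; rewrite nth_mkseq.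
Qed.

Lemma WKL_reject p r : dom (realizer_version WKL) p ->
  realizer_version WKL p r <->
  (forall i, bit (r i)) /\ forall n, ~~ reject_tree (mkseq p n) (mkseq r n).
Proof.
by move=> [r0 /WKL_E[pT _]]; rewrite WKL_E reject_treeP; split=> [[]|].
Qed.

(** Testing all prefixes, not just w, closes the set under prefixes, as a tree requires; the first
    conjunct keeps its words binary. *)
Definition unrefuted (u w : seq nat) : bool :=
  ~~ has (fun i => 1 < nth 0 w i) (iota 0 (size w)) &&
  ~~ has (fun m => bad reject_tree (take m u) (take m w)) (iota 0 (size w).+1).

Definition unrefuted_tree (u : seq nat) (n : nat) : nat :=
  unrefuted u (CodeSeq.decode n).

Lemma cfun_unrefuted_tree :
  cfun (fun y : seq nat * nat => unrefuted_tree y.1 y.2).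
Proof.
rewrite /unrefuted_tree /unrefuted; cfun_auto.
by apply: (cfun_bad cfun_reject_tree); cfun_auto.
Qed.

Definition solutions_tree_name (q0 : baire) : baire :=
  fun n => unrefuted_tree (mkseq q0 n) n.

(** Only input letters below the length of w matter. Thus the name, which tests w with as many
    letters as its code, describes the same tree as a test with [size w] letters. *)
Lemma unrefutedP q0 w N : size w <= N -> unrefuted (mkseq q0 N) w <->
  all (fun a => a < 2) w /\
  forall m, m <= size w -> ~~ bad reject_tree (mkseq q0 m) (take m w).
Proof.
move=> wN; rewrite /unrefuted; split.
  move=> /andP[/hasPn h1 /hasPn h2]; split.
    apply/(all_nthP 0) => i iw; rewrite ltnS leqNgt h1 //.
    by rewrite mem_iota.
  move=> m mw; have := h2 m; rewrite mem_iota ltnS take_mkseq.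
  by rewrite (minn_idPl (leq_trans mw wN)); apply.
move=> [/(all_nthP 0) h1 h2]; apply/andP; split; apply/hasPn => i.
  by rewrite mem_iota /= add0n => /h1; rewrite ltnS -leqNgt.
rewrite mem_iota /= add0n ltnS => iw.
by rewrite take_mkseq (minn_idPl (leq_trans iw wN)); apply: h2.
Qed.

Lemma solutions_tree q0 : exists T, tree_name (solutions_tree_name q0) T.
Proof.
pose T w := unrefuted (mkseq q0 (size w)) w.
have TP w : T w <-> all (fun a => a < 2) w /\
  forall m, m <= size w -> ~~ bad reject_tree (mkseq q0 m) (take m w).
  exact: unrefutedP.
have treeT : is_binary_tree T.
  split=> [w /TP[]//|v w /prefixP[u ->] /TP[]].
  rewrite all_cat => /andP[av _] h.
  apply/TP; split=> // m mv; have := h m; rewrite takel_cat //; apply.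
  by rewrite size_cat (leq_trans mv) ?leq_addr.
exists (exist _ T treeT) => w /=; congr nat_of_bool.
rewrite /unrefuted_tree CodeSeq.codeK; apply/idP/idP.
  by move/unrefutedP => h; apply/TP/h/size_code.
by move/TP => h; apply/unrefutedP => //; apply: size_code.
Qed.

(** Prefixes of t differ in length, so one path makes the tree infinite. The promise of [WKL] for
    the tree of solutions thus follows from the existence of a solution. *)
Lemma infinite_branch (T : pred (seq nat)) (t : baire) :
  (forall n, T (mkseq t n)) -> infinite_set [set w | T w].
Proof.
move=> tT fT; apply: infinite_nat.
have := finite_preimage (f := mkseq t) _ fT.
rewrite (_ : _ @^-1` _ = setT); last by apply/seteqP; split=> n // _; apply: tT.
by apply=> m n _ _ /(congr1 size); rewrite !size_mkseq.
Qed.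

Lemma WKL_solutions q0 : (exists t, solution bit reject_tree q0 t) -> forall r,
  realizer_version WKL (solutions_tree_name q0) r <->
  solution bit reject_tree q0 r.
Proof.
have [T qT] := solutions_tree q0.
have path r : (forall i, bit (r i)) ->
    (forall n, solutions_tree_name q0 (CodeSeq.code (mkseq r n)) != 0) <->
    forall n, ~~ bad reject_tree (mkseq q0 n) (mkseq r n).
  move=> rb.
  have nameE n : solutions_tree_name q0 (CodeSeq.code (mkseq r n)) != 0 <->
      forall m, m <= n -> ~~ bad reject_tree (mkseq q0 m) (mkseq r m).
    rewrite /solutions_tree_name /unrefuted_tree CodeSeq.codeK eqb0 negbK.
    have := size_code (mkseq r n) => /(unrefutedP q0) ->; rewrite size_mkseq.
    split=> [[_ h] m mn|h].
      by have := h m mn; rewrite take_mkseq (minn_idPl mn).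
    split; last by move=> m mn; rewrite take_mkseq (minn_idPl mn) h.
    by apply/allP => _ /mapP[i _ ->]; apply: rb.
  split=> [h n|h n]; first by move/nameE: (h n); apply.
  by apply/nameE => m _; apply: h.
move=> [t [tb tS]] r; rewrite WKL_E; split=> [[_ [rb rP]]|[rb rS]].
  exact: conj rb ((path r rb).1 rP).
have rP := (path r rb).2 rS; have tP := (path t tb).2 tS.
split; last exact: conj rb rP.
exists T; split; first exact: qT.
apply: (@infinite_branch _ t) => n.
by have := tP n; rewrite qT; case: (sval T _).
Qed.

Definition zero_tree_name : baire := fun n =>
  CodeSeq.decode n == mkseq (fun=> 0) (size (CodeSeq.decode n)).

Lemma WKL_zero_tree_name : realizer_version WKL zero_tree_name = [set fun=> 0].
Proof.
have zero_branch (r : baire) n :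
    zero_tree_name (CodeSeq.code (mkseq r n)) != 0 <->
    mkseq r n = mkseq (fun=> 0) n.
  rewrite /zero_tree_name CodeSeq.codeK size_mkseq eqb0 negbK.
  by split=> /eqP.
apply/seteqP; split=> [r /WKL_E[_ [_ rP]]|_ ->].
  apply/funext => k; have /zero_branch := rP k.+1.
  by move=> /(congr1 (nth 0 ^~ k)); rewrite !nth_mkseq.
apply/WKL_E; split; last by split=> // n; apply/zero_branch.
pose T (w : seq nat) := w == mkseq (fun=> 0) (size w).
have treeT : is_binary_tree T.
  split=> [w /eqP ->|v w]; first by apply/allP => _ /mapP[i _ ->].
  rewrite prefixE => /eqP e /eqP wz; have := congr1 (take (size v)) wz.
  by rewrite e take_mkseq => ez; rewrite /T ez size_mkseq.
exists (exist _ T treeT); split.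
  by move=> w; rewrite /zero_tree_name CodeSeq.codeK.
by apply: (@infinite_branch _ (fun=> 0)) => n; rewrite /= /T size_mkseq.
Qed.

Lemma WKL_infloop : sW_equiv (infloop WKL) WKL.
Proof.
split.
  apply: (sW_infloop_le (letter := bit) (k := solutions_tree_name) isT isT
    reject_tree_mono WKL_reject cfun_reject_tree _ cfun_unrefuted_tree) => //.
  move=> p dp; apply: WKL_solutions.
  exact: (solution_exists (letter := bit) isT isT reject_tree_mono WKL_reject).
apply: (sW_le_infloop _ WKL_zero_tree_name).
by apply/cfun_nat; rewrite /zero_tree_name; cfun_auto.
Qed.

Theorem corollary27 :
  sW_equiv (infloop C_cantor) C_cantor /\
  sW_equiv (infloop C_baire) C_baire /\
  sW_equiv (infloop UC_baire) UC_baire /\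
  sW_equiv (infloop WKL) WKL.
Proof.
have natP a : (predT : pred nat) a <-> exists b, id b = a.
  by split=> // _; exists a.
split; first exact: (closed_choice_infloop nat_of_bool_inj bitP).
split; first exact: (closed_choice_infloop (@inj_id nat) natP).
split; first exact: (unique_choice_infloop (@inj_id nat) natP).
exact: WKL_infloop.
Qed.
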